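(* Let $(M,F)$ be a Finsler manifold of dimension $n\ge 3$ whose Berwald curvature satisfies, on $TM_0$, $$B^i_{\ jkl}=(\mu_jh_{kl}+\mu_kh_{jl}+\mu_lh_{jk})y^i+\lambda\big(h^i_j h_{kl}+h^i_k h_{jl}+h^i_l h_{jk}\big),$$ where $\mu_i=\mu_i(x,y)$ and $\lambda=\lambda(x,y)$ are positively homogeneous in $y$ of degrees $-2$ and $-1$ respectively. Suppose that the Douglas tensor of $F$ vanishes, $D^i_{\ jkl}=0$. Then $F$ is a Randers metric.
   Context: $M$ is an $n$-dimensional $C^\infty$ manifold and $TM_0=TM\setminus\{0\}$ is the slit tangent bundle, with standard local coordinates $(x^i,y^i)$. A Finsler metric $F:TM\to[0,\infty)$ is $C^\infty$ on $TM_0$, positively 1-homogeneous on fibers, and such that $g_{ij}=\frac12\frac{\partial^2 F^2}{\partial y^i\partial y^j}$ is positive definite on $TM_0$. Indices are lowered and raised with $g_{ij}$ and its inverse $g^{ij}$; $y_i=g_{ij}y^j$, $h_{ij}=g_{ij}-F^{-2}y_iy_j$ (angular metric), $h^i_j=\delta^i_j-F^{-2}y^iy_j$. Spray coefficients: $G^i=\frac14 g^{il}\left\{\frac{\partial^2 F^2}{\partial x^k\partial y^l}y^k-\frac{\partial F^2}{\partial x^l}\right\}$. Berwald curvature: $B^i_{\ jkl}=\frac{\partial^3G^i}{\partial y^j\partial y^k\partial y^l}$. Douglas tensor: $D^i_{\ jkl}=\frac{\partial^3}{\partial y^j\partial y^k\partial y^l}\left(G^i-\frac{1}{n+1}\frac{\partial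 G^m}{\partial y^m}y^i\right)$. A Randers metric is a Finsler metric of the form $F=\alpha+\beta$ with $\alpha=\sqrt{a_{ij}(x)y^iy^j}$ a Riemannian metric and $\beta=b_i(x)y^i$ a 1-form on $M$ with $\sqrt{a^{ij}b_ib_j}<1$. In the assumed form of the Berwald curvature, $\mu_i$ are the components of a covector field along $TM_0$ and $\lambda$ is a scalar function on $TM_0$; since $B^i_{\ jkl}y^j=0$, one has $\mu_iy^i=0$.
   Formalization: The formal theorem additionally assumes that λ does not vanish identically on any nonempty open subset of TM_0; with λ = μ = 0 the claim fails, e.g. for the non-Randers Minkowski metric F² = |y|² + √(y₁⁴+y₂⁴+y₃⁴) on R³. *)

(* Defs.v *)
From HB Require Import structures.
From mathcomp Require Import all_boot all_order all_algebra.
From mathcomp Require Import all_classical all_reals all_analysis.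

Set Implicit Arguments.
Unset Strict Implicit.
Unset Printing Implicit Defensive.

Import Order.TTheory GRing.Theory Num.Theory.
Import numFieldNormedType.Exports.

Local Open Scope classical_set_scope.
Local Open Scope ring_scope.

Fixpoint iter_derive (R : realType) (V W : normedModType R) (f : V -> W)
    (vs : seq V) : V -> W :=
  if vs is v :: vs' then 'D_v (iter_derive f vs') else f.

(* On an open subset [A] of a finite-dimensional space this is [C^oo]. *)
Definition smooth_on (R : realType) (V W : normedModType R) (A : set V)
    (f : V -> W) : Prop :=
  forall (vs : seq V) (x : V), A x ->
    {for x, continuous (iter_derive f vs)} /\
    forall v : V, derivable (iter_derive f vs) x v.

(* The functions [coord a] and [coord_inv a] are only meaningful on [dom a]
   and on its image.  The atlas need not be maximal. *)
Record smooth_manifold (R : realType) (n : nat) (M : topologicalType) := {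
  chart : Type ;
  dom : chart -> set M ;
  coord : chart -> M -> 'rV[R]_n ;
  coord_inv : chart -> 'rV[R]_n -> M ;
  manifold_hausdorff : hausdorff_space M ;
  manifold_second_countable : @second_countable M ;
  dom_open : forall a, open (dom a) ;
  dom_cover : forall p, exists a, dom a p ;
  coord_open : forall a, open (coord a @` dom a) ;
  coordK : forall a p, dom a p -> coord_inv a (coord a p) = p ;
  coord_continuous : forall a, {within dom a, continuous (coord a)} ;
  coord_inv_continuous :
    forall a, {within coord a @` dom a, continuous (coord_inv a)} ;
  transition_smooth : forall a b,
    smooth_on (coord a @` (dom a `&` dom b)) (coord b \o coord_inv a)
}.

Definition transition (R : realType) (n : nat) (M : topologicalType)
    (X : smooth_manifold R n M) (a b : chart X) : 'rV[R]_n -> 'rV[R]_n :=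
  coord b \o coord_inv a.

Definition overlap (R : realType) (n : nat) (M : topologicalType)
    (X : smooth_manifold R n M) (a b : chart X) : set 'rV[R]_n :=
  coord a @` (dom a `&` dom b).

(* The entry (i, j) is the derivative of the j-th new coordinate with respect
   to the i-th old one, so that [y *m trans_jac a b x] is the row of the new
   components of the tangent vector with old components [y]. *)
Definition trans_jac (R : realType) (n : nat) (M : topologicalType)
    (X : smooth_manifold R n M) (a b : chart X) (x : 'rV[R]_n) : 'M[R]_n :=
  jacobian (transition a b) x.

(* A point of TM is described in the chart [a] by its standard coordinates
   z = (x, y). *)
Definition tm_dom (R : realType) (n : nat) (M : topologicalType)
    (X : smooth_manifold R n M) (a : chart X) : set ('rV[R]_n * 'rV[R]_n) :=
  [set z | (coord a @` dom a) z.1].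

Definition slit_dom (R : realType) (n : nat) (M : topologicalType)
    (X : smooth_manifold R n M) (a : chart X) : set ('rV[R]_n * 'rV[R]_n) :=
  [set z | (coord a @` dom a) z.1 /\ z.2 != 0].

Definition tm_transition (R : realType) (n : nat) (M : topologicalType)
    (X : smooth_manifold R n M) (a b : chart X) (z : 'rV[R]_n * 'rV[R]_n) :
    'rV[R]_n * 'rV[R]_n :=
  (transition a b z.1, z.2 *m trans_jac a b z.1).

(* Tensorial objects are given as in classical tensor calculus: one family of
   components per chart, subject to the transformation rule. *)
Definition tm_function (R : realType) (n : nat) (M : topologicalType)
    (X : smooth_manifold R n M)
    (f : chart X -> 'rV[R]_n * 'rV[R]_n -> R) : Prop :=
  forall (a b : chart X) z, overlap a b z.1 ->
    f a z = f b (tm_transition a b z).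

Definition slit_function (R : realType) (n : nat) (M : topologicalType)
    (X : smooth_manifold R n M)
    (f : chart X -> 'rV[R]_n * 'rV[R]_n -> R) : Prop :=
  forall (a b : chart X) z, overlap a b z.1 -> z.2 != 0 ->
    f a z = f b (tm_transition a b z).

Definition slit_covector (R : realType) (n : nat) (M : topologicalType)
    (X : smooth_manifold R n M)
    (mu : chart X -> 'rV[R]_n * 'rV[R]_n -> 'rV[R]_n) : Prop :=
  forall (a b : chart X) z, overlap a b z.1 -> z.2 != 0 ->
    mu a z = mu b (tm_transition a b z) *m (trans_jac a b z.1)^T.

Definition pos_homogeneous (R : realType) (n : nat) (W : lmodType R) (k : int)
    (A : set ('rV[R]_n * 'rV[R]_n)) (f : 'rV[R]_n * 'rV[R]_n -> W) : Prop :=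
  forall (z : 'rV[R]_n * 'rV[R]_n) (t : R), A z -> 0 < t ->
    f (z.1, t *: z.2) = (t ^ k) *: f z.

Definition posdef (R : realType) (n : nat) (A : 'M[R]_n) : Prop :=
  forall v : 'rV[R]_n, v != 0 -> 0 < \sum_i \sum_j A i j * v 0 i * v 0 j.

Definition dx (R : realType) (n : nat) (k : 'I_n)
    (f : 'rV[R]_n * 'rV[R]_n -> R) : 'rV[R]_n * 'rV[R]_n -> R :=
  fun z => 'D_('e_k, 0) f z.

Definition dy (R : realType) (n : nat) (k : 'I_n)
    (f : 'rV[R]_n * 'rV[R]_n -> R) : 'rV[R]_n * 'rV[R]_n -> R :=
  fun z => 'D_(0, 'e_k) f z.

(* In the next definitions [F] is the expression of the metric in one chart. *)
Definition fund_tensor (R : realType) (n : nat)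
    (F : 'rV[R]_n * 'rV[R]_n -> R) (z : 'rV[R]_n * 'rV[R]_n) : 'M[R]_n :=
  \matrix_(i, j) (2^-1 * dy i (dy j (fun w => F w ^+ 2)) z).

Definition y_low (R : realType) (n : nat) (F : 'rV[R]_n * 'rV[R]_n -> R)
    (i : 'I_n) (z : 'rV[R]_n * 'rV[R]_n) : R :=
  \sum_j fund_tensor F z i j * z.2 0 j.

Definition angular (R : realType) (n : nat) (F : 'rV[R]_n * 'rV[R]_n -> R)
    (i j : 'I_n) (z : 'rV[R]_n * 'rV[R]_n) : R :=
  fund_tensor F z i j - F z ^- 2 * y_low F i z * y_low F j z.

(* [angular_mixed F i j] is h^i_j. *)
Definition angular_mixed (R : realType) (n : nat)
    (F : 'rV[R]_n * 'rV[R]_n -> R) (i j : 'I_n)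
    (z : 'rV[R]_n * 'rV[R]_n) : R :=
  (i == j)%:R - F z ^- 2 * z.2 0 i * y_low F j z.

Definition spray (R : realType) (n : nat) (F : 'rV[R]_n * 'rV[R]_n -> R)
    (i : 'I_n) (z : 'rV[R]_n * 'rV[R]_n) : R :=
  4^-1 * \sum_l invmx (fund_tensor F z) i l *
    ((\sum_k dx k (dy l (fun w => F w ^+ 2)) z * z.2 0 k)
     - dx l (fun w => F w ^+ 2) z).

Definition berwald (R : realType) (n : nat) (F : 'rV[R]_n * 'rV[R]_n -> R)
    (i j k l : 'I_n) : 'rV[R]_n * 'rV[R]_n -> R :=
  dy j (dy k (dy l (spray F i))).

Definition douglas (R : realType) (n : nat) (F : 'rV[R]_n * 'rV[R]_n -> R)
    (i j k l : 'I_n) : 'rV[R]_n * 'rV[R]_n -> R :=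
  dy j (dy k (dy l (fun z =>
    spray F i z - (n.+1%:R)^-1 * (\sum_m dy m (spray F m) z) * z.2 0 i))).

Definition finsler (R : realType) (n : nat) (M : topologicalType)
    (X : smooth_manifold R n M)
    (F : chart X -> 'rV[R]_n * 'rV[R]_n -> R) : Prop :=
  [/\ tm_function F,
      forall a z, tm_dom a z -> 0 <= F a z,
      forall a, smooth_on (slit_dom a) (F a),
      forall a, pos_homogeneous (W := R^o) 1 (tm_dom a) (F a) &
      forall a z, slit_dom a z -> posdef (fund_tensor (F a) z)].

Definition riemannian (R : realType) (n : nat) (M : topologicalType)
    (X : smooth_manifold R n M) (g : chart X -> 'rV[R]_n -> 'M[R]_n) : Prop :=
  [/\ forall a b x, overlap a b x ->
        g a x = trans_jac a b x *m g b (transition a b x) *m (trans_jac a b x)^T,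
      forall a, smooth_on (coord a @` dom a) (g a),
      forall a x, (coord a @` dom a) x -> (g a x)^T = g a x &
      forall a x, (coord a @` dom a) x -> posdef (g a x)].

Definition one_form (R : realType) (n : nat) (M : topologicalType)
    (X : smooth_manifold R n M) (b : chart X -> 'rV[R]_n -> 'rV[R]_n) : Prop :=
  (forall c d x, overlap c d x ->
     b c x = b d (transition c d x) *m (trans_jac c d x)^T) /\
  (forall c, smooth_on (coord c @` dom c) (b c)).

Definition randers (R : realType) (n : nat) (M : topologicalType)
    (X : smooth_manifold R n M)
    (F : chart X -> 'rV[R]_n * 'rV[R]_n -> R) : Prop :=
  finsler F /\
  exists (g : chart X -> 'rV[R]_n -> 'M[R]_n)
         (b : chart X -> 'rV[R]_n -> 'rV[R]_n),
    [/\ riemannian g,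
        one_form b,
        forall c x, (coord c @` dom c) x ->
          Num.sqrt (\sum_i \sum_j invmx (g c x) i j * b c x 0 i * b c x 0 j) < 1 &
        forall c x y, (coord c @` dom c) x ->
          F c (x, y) =
            Num.sqrt (\sum_i \sum_j g c x i j * y 0 i * y 0 j)
            + \sum_i b c x 0 i * y 0 i].

(* Main.v *)
Require Import Defs.
From HB Require Import structures.
From mathcomp Require Import all_boot all_order all_algebra.
From mathcomp Require Import all_classical all_reals all_analysis.
From mathcomp Require Import ring lra.
Import Order.TTheory GRing.Theory Num.Theory.
Import numFieldNormedType.Exports.
Set Implicit Arguments.
Unset Strict Implicit.
Unset Printing Implicit Defensive.
Local Open Scope classical_set_scope.
Local Open Scope ring_scope.

(* Put E = (n+1)^-1 dG^m/dy^m.  The vanishing of the Douglas tensor says that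
   the third y-derivatives of E y^i are B^i_jkl.  Contracting the assumed form
   of B with vectors gives E_jk = phi F_jk with phi = lam F, and E_jkl is the
   symmetrisation of nu_j F_kl; together they force phi to be constant on the
   fibres and F_jkl to be the symmetrisation of kappa_j F_kl wherever lam does
   not vanish.  The integrability conditions of this system (here n >= 3 is
   used) imply that f = F restricted to an affine line of a fibre solves
   Halphen's equation 9 f''^2 f''''' - 45 f'' f''' f'''' + 40 f'''^3 = 0, that
   is (f''^(-2/3))''' = 0; by density this holds on every line avoiding 0.
   So f''^(-2/3) is a quadratic polynomial Q on each line.  Comparing the lines
   u + R v and v + R u shows that the Hessian of F is even.  Hence the odd part
   of F in y is affine on lines, thus a linear form beta, and the even part
   alpha equals sqrt Q up to a constant factor, so that alpha^2 is a quadratic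
   form. *)

(** * Algebra of smooth functions *)

(** If lam and mu vanish, every Minkowski norm satisfies the equations, so F is constrained only
    where lam is nonzero; continuity carries Halphen's equation to the other points, lam having no
    open set of zeros. Neither mu nor lam is assumed smooth, so nothing containing them is
    differentiated: phi and kappa are rewritten as quotients of derivatives of E and F.

    Since h_jk = F F_jk, the relation that F_jkl is the symmetrisation of kappa_j F_kl is
    C-reducibility. Kropina norms alpha^2 / beta satisfy it too; on a line their Q is the square of
    a linear function and vanishes somewhere, and they are excluded because f'' is positive on every
    whole line avoiding 0.

    The exponent -2/3 comes from (sqrt Q)'' = D Q^(-3/2), with D a quarter of minus the discriminant
    of Q. Evenness arises because homogeneity relates the polynomials of the two lines for positive
    parameters only, whereas an identity of polynomials persists for negative ones, where the two
    points lie on opposite rays. *)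

Section SmoothAlgebra.
Context {R : realType} {V : normedModType R}.
Implicit Types (f g : V -> R) (A : set V) (x v w : V).

(** [iter_derive] adds new derivatives on the outside; here the innermost one is peeled off. The
    product and quotient rules then express the derivative through functions to which the induction
    hypothesis on [k] applies. *)
Fixpoint Ck (k : nat) A f : Prop :=
  (forall x, A x -> {for x, continuous f}) /\
  if k is k'.+1 then
    (forall x v, A x -> derivable f x v) /\ forall v, Ck k' A ('D_v f)
  else True.

Lemma iter_derive_rcons f vs v :
  iter_derive f (rcons vs v) = iter_derive ('D_v f) vs.
Proof. by elim: vs => //= w vs ->. Qed.

Lemma smooth_onP A f : smooth_on A f <-> forall k, Ck k A f.
Proof.
split=> [+ k|].
  elim: k f => [|k IH] f fA; split => //.
  - by move=> x /(fA [::])[].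
  - by move=> x /(fA [::])[].
  split=> [x v /(fA [::])[_]//|v]; apply: IH => vs x Ax.
  by rewrite -iter_derive_rcons; exact: fA.
move=> fA vs; elim/last_ind: vs f fA => [|vs v IH] f fA x Ax.
  have [fc [fd _]] := fA 1%N.
  by split=> [|v]; [exact: fc|exact: fd].
rewrite iter_derive_rcons; apply: IH => // k.
by have [_ [_]] := fA k.+1; apply.
Qed.

Lemma smooth_on_continuous A f x : smooth_on A f -> A x -> {for x, continuous f}.
Proof. by move=> /(_ [::] x) fA /fA[]. Qed.

Lemma smooth_on_derivable A f x v : smooth_on A f -> A x -> derivable f x v.
Proof. by move=> /(_ [::] x) fA /fA[]. Qed.

Lemma smooth_onD A f v : smooth_on A f -> smooth_on A ('D_v f).
Proof. by move=> fA vs x Ax; rewrite -iter_derive_rcons; exact: fA. Qed.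

Lemma smooth_onS A B f : B `<=` A -> smooth_on A f -> smooth_on B f.
Proof. by move=> BA fA vs x /BA; exact: fA. Qed.

Lemma near_open A (P : V -> Prop) x : open A -> A x -> (forall y, A y -> P y) ->
  \forall y \near x, P y.
Proof.
move=> oA Ax AP; near=> y; apply: AP; near: y; exact: open_nbhs_nbhs.
Unshelve. all: by end_near. Qed.

Lemma eq_derive_on A f g x v : open A -> A x -> (forall y, A y -> f y = g y) ->
  'D_v f x = 'D_v g x.
Proof. by move=> oA Ax fg; apply: near_eq_derive; exact: near_open fg. Qed.

Lemma eq_Ck k A f g : open A -> (forall y, A y -> f y = g y) ->
  Ck k A f -> Ck k A g.
Proof.
move=> oA; elim: k f g => [|k IH] f g fg /= [fc fd]; split => //.
- move=> x Ax; rewrite /continuous_at /prop_for -(fg _ Ax).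
  by apply: cvg_trans (fc _ Ax); apply: near_eq_cvg; exact: near_open fg.
- move=> x Ax; rewrite /continuous_at /prop_for -(fg _ Ax).
  by apply: cvg_trans (fc _ Ax); apply: near_eq_cvg; exact: near_open fg.
case: fd => fd fk; split => [x v Ax|v].
  by apply: near_eq_derivable (fd x v Ax); exact: near_open fg.
by apply: IH (fk v) => y Ay; exact: eq_derive_on fg.
Qed.

Lemma eq_smooth_on A f g : open A -> (forall y, A y -> f y = g y) ->
  smooth_on A f -> smooth_on A g.
Proof.
by move=> oA fg /smooth_onP fA; apply/smooth_onP => k; exact: eq_Ck fg (fA k).
Qed.

Lemma CkS k A f : Ck k.+1 A f -> Ck k A f.
Proof.
elim: k f => [|k IH] f /= [fc [fd fk]]; split => //.
by split => // v; apply: IH; exact: fk.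
Qed.

Lemma Ck_cst k A (c : R) : Ck k A (fun=> c).
Proof.
elim: k c => [|k IH] c /=; split => //; try by move=> x _; exact: cvg_cst.
split => [x v _|v]; first exact: derivable_cst.
have -> : 'D_v (fun=> c) = (fun=> 0) :> (V -> R) by apply/funext => x; exact: derive_cst.
exact: IH.
Qed.

Lemma Ck_add k A f g : open A -> Ck k A f -> Ck k A g -> Ck k A (fun x => f x + g x).
Proof.
move=> oA; elim: k f g => [|k IH] f g /= [fc fd] [gc gd]; split => //.
- by move=> x Ax; apply: cvgD; [exact: fc|exact: gc].
- by move=> x Ax; apply: cvgD; [exact: fc|exact: gc].
move: fd gd => [fd fk] [gd gk]; split => [x v Ax|v].
  by apply: derivableD; [exact: fd|exact: gd].
apply: eq_Ck (IH _ _ (fk v) (gk v)) => // y Ay.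
by rewrite -deriveD//; [exact: fd|exact: gd].
Qed.

Lemma Ck_mul k A f g : open A -> Ck k A f -> Ck k A g -> Ck k A (fun x => f x * g x).
Proof.
move=> oA; elim: k f g => [|k IH] f g Hf Hg.
  split => // x Ax; case: Hf Hg => fc _ [gc _].
  by apply: cvgM; [exact: fc|exact: gc].
have [fc [fd fk]] := Hf; have [gc [gd gk]] := Hg.
split; first by move=> x Ax; apply: cvgM; [exact: fc|exact: gc].
split => [x v Ax|v].
  by apply: derivableM; [exact: fd|exact: gd].
have := Ck_add oA (IH _ _ (CkS Hf) (gk v)) (IH _ _ (CkS Hg) (fk v)).
apply: eq_Ck => // y Ay.
by rewrite -[RHS]/('D_v (f * g) y) deriveM//; [exact: fd|exact: gd].
Qed.

Lemma Ck_inv k A f : open A -> (forall x, A x -> f x != 0) ->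
  Ck k A f -> Ck k A (fun x => (f x)^-1).
Proof.
move=> oA f0; elim: k => [|k IH] Hf.
  by split => // x Ax; case: Hf => fc _; apply: cvgV; [exact: f0|exact: fc].
have [fc [fd fk]] := Hf.
split; first by move=> x Ax; apply: cvgV; [exact: f0|exact: fc].
split => [x v Ax|v].
  by apply: derivableV; [exact: f0|exact: fd].
have If := IH (CkS Hf).
have := Ck_mul oA (Ck_mul oA (Ck_cst k A (-1)) (Ck_mul oA If If)) (fk v).
apply: eq_Ck => // y Ay.
rewrite [RHS]deriveV//; [|exact: f0|exact: fd].
by rewrite /GRing.scale/= mulN1r expr2 invfM.
Qed.

Lemma smooth_on_cst A (c : R) : smooth_on A (fun=> c).
Proof. by apply/smooth_onP => k; exact: Ck_cst. Qed.

Lemma smooth_on_add A f g : open A -> smooth_on A f -> smooth_on A g ->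
  smooth_on A (fun x => f x + g x).
Proof. by move=> oA /smooth_onP ? /smooth_onP ?; apply/smooth_onP => k; exact: Ck_add. Qed.

Lemma smooth_on_mul A f g : open A -> smooth_on A f -> smooth_on A g ->
  smooth_on A (fun x => f x * g x).
Proof. by move=> oA /smooth_onP ? /smooth_onP ?; apply/smooth_onP => k; exact: Ck_mul. Qed.

Lemma smooth_on_inv A f : open A -> (forall x, A x -> f x != 0) ->
  smooth_on A f -> smooth_on A (fun x => (f x)^-1).
Proof. by move=> oA f0 /smooth_onP ?; apply/smooth_onP => k; exact: Ck_inv. Qed.

Lemma smooth_on_opp A f : open A -> smooth_on A f -> smooth_on A (fun x => - f x).
Proof.
move=> oA fA; have := smooth_on_mul oA (smooth_on_cst (-1)) fA.
by apply: eq_smooth_on => // y _; rewrite mulN1r.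
Qed.

Lemma smooth_on_sub A f g : open A -> smooth_on A f -> smooth_on A g ->
  smooth_on A (fun x => f x - g x).
Proof. by move=> oA fA gA; exact: (smooth_on_add oA fA (smooth_on_opp oA gA)). Qed.

Lemma smooth_on_exp A f m : open A -> smooth_on A f -> smooth_on A (fun x => f x ^+ m).
Proof.
move=> oA fA; elim: m => [|m IH]; first exact: smooth_on_cst.
by apply: eq_smooth_on (smooth_on_mul oA fA IH) => // y _; rewrite exprS.
Qed.

Lemma smooth_on_sum A (I : Type) (s : seq I) (P : pred I) (f : I -> V -> R) :
  open A -> (forall i, smooth_on A (f i)) ->
  smooth_on A (fun x => \sum_(i <- s | P i) f i x).
Proof.
move=> oA fA; elim: s => [|i s IH].
  by apply: eq_smooth_on (smooth_on_cst 0) => // y _; rewrite big_nil.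
case Pi: (P i).
  by apply: eq_smooth_on (smooth_on_add oA (fA i) IH) => // y _; rewrite big_cons Pi.
by apply: eq_smooth_on IH => // y _; rewrite big_cons Pi.
Qed.

Lemma smooth_on_prod A (I : Type) (s : seq I) (P : pred I) (f : I -> V -> R) :
  open A -> (forall i, smooth_on A (f i)) ->
  smooth_on A (fun x => \prod_(i <- s | P i) f i x).
Proof.
move=> oA fA; elim: s => [|i s IH].
  by apply: eq_smooth_on (smooth_on_cst 1) => // y _; rewrite big_nil.
case Pi: (P i).
  by apply: eq_smooth_on (smooth_on_mul oA (fA i) IH) => // y _; rewrite big_cons Pi.
by apply: eq_smooth_on IH => // y _; rewrite big_cons Pi.
Qed.

Lemma smooth_on_det A n (M : V -> 'M[R]_n) : open A ->
  (forall i j, smooth_on A (fun x => M x i j)) -> smooth_on A (fun x => \det (M x)).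
Proof.
move=> oA MA; apply: smooth_on_sum => // s.
apply: (smooth_on_mul oA (smooth_on_cst _)).
by apply: (smooth_on_prod _ _ oA) => i; exact: MA.
Qed.

Lemma smooth_on_invmx A n (M : V -> 'M[R]_n) i j : open A ->
  (forall i j, smooth_on A (fun x => M x i j)) ->
  (forall x, A x -> M x \in unitmx) -> smooth_on A (fun x => invmx (M x) i j).
Proof.
move=> oA MA Mu.
have dA : smooth_on A (fun x => (\det (M x))^-1).
  apply: smooth_on_inv => //; last exact: smooth_on_det.
  by move=> x /Mu; rewrite unitmxE unitfE.
have cA : smooth_on A (fun x => cofactor (M x) j i).
  apply: (smooth_on_mul oA (smooth_on_cst _)).
  apply: (smooth_on_det oA) => k l.
  by apply: eq_smooth_on (MA (lift j k) (lift i l)) => // y _; rewrite !mxE.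
apply: eq_smooth_on (smooth_on_mul oA dA cA) => // y Ay.
by rewrite /invmx (Mu _ Ay) !mxE.
Qed.

Section Rules.
Variables (A : set V) (x : V).
Hypotheses (oA : open A) (Ax : A x).

Lemma derive_add f g v : smooth_on A f -> smooth_on A g ->
  'D_v (fun x => f x + g x) x = 'D_v f x + 'D_v g x.
Proof. by move=> fA gA; apply: deriveD; exact: smooth_on_derivable Ax. Qed.

Lemma derive_sub f g v : smooth_on A f -> smooth_on A g ->
  'D_v (fun x => f x - g x) x = 'D_v f x - 'D_v g x.
Proof. by move=> fA gA; apply: deriveB; exact: smooth_on_derivable Ax. Qed.

Lemma derive_mul f g v : smooth_on A f -> smooth_on A g ->
  'D_v (fun x => f x * g x) x = 'D_v f x * g x + f x * 'D_v g x.
Proof.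
move=> fA gA; rewrite [LHS](@deriveM _ _ f g); last 2 first.
- exact: smooth_on_derivable Ax.
- exact: smooth_on_derivable Ax.
by rewrite addrC /GRing.scale/= [g x * _]mulrC.
Qed.

Lemma derive_mulc f (c : R) v : smooth_on A f ->
  'D_v (fun x => c * f x) x = c * 'D_v f x.
Proof.
by move=> fA; rewrite (derive_mul _ (smooth_on_cst c) fA) derive_cst mul0r add0r.
Qed.

Lemma derive_bigsum (I : Type) (s : seq I) (P : pred I) (f : I -> V -> R) v :
  (forall i, smooth_on A (f i)) ->
  'D_v (fun x => \sum_(i <- s | P i) f i x) x = \sum_(i <- s | P i) 'D_v (f i) x.
Proof.
move=> fA; elim: s => [|i s IH].
  rewrite big_nil -[RHS](derive_cst (0 : R) x v).
  by congr ('D_v _ x); apply/funext => y; rewrite big_nil.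
rewrite big_cons -IH; case: ifP => Pi.
  rewrite -derive_add//; last exact: smooth_on_sum.
  by congr ('D_v _ x); apply/funext => y; rewrite big_cons Pi.
by congr ('D_v _ x); apply/funext => y; rewrite big_cons Pi.
Qed.

End Rules.
End SmoothAlgebra.

(** * Linearity and symmetry of directional derivatives *)

Section DirectionalDerivatives.
Context {R : realType} {V : normedModType R}.
Implicit Types (f : V -> R) (A : set V) (x v w : V).

Lemma is_derive_line f x v (t : R) : derivable f (x + t *: v) v ->
  is_derive t 1 (fun s : R => f (x + s *: v)) ('D_v f (x + t *: v)).
Proof.
have E : (fun h : R => h^-1 *: (f (x + (h *: 1 + t) *: v) - f (x + t *: v))) =
  (fun h : R => h^-1 *: (f (h *: v + (x + t *: v)) - f (x + t *: v))).
  apply/funext => h; congr (_ *: (f _ - _)).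
  by rewrite scalerDl /GRing.scale/= mulr1 addrCA.
move=> fv; apply: DeriveDef.
  by rewrite /derivable /= E.
by rewrite /derive /= E.
Qed.

Lemma derive_dirZ f x v (a : R) : derivable f x v ->
  is_derive x (a *: v) f (a * 'D_v f x).
Proof.
move=> fv; have fv0 : derivable f (x + (a * 0) *: v) v by rewrite mulr0 scale0r addr0.
have H := is_derive_line fv0.
have H1 : is_derive (0 : R) (1 : R) ( *%R a) a.
  by apply: is_derive_eq; rewrite /GRing.scale/= ?mulr1.
have H2 := @is_derive1_comp _ (fun s : R => f (x + s *: v)) ( *%R a) _ _ _ H H1.
have E : (fun h : R => h^-1 *: (f (x + (a * (h *: 1 + 0)) *: v) - f (x + (a * 0) *: v))) =
  (fun h : R => h^-1 *: (f (h *: (a *: v) + x) - f x)).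
  apply/funext => h; rewrite mulr0 scale0r !addr0; congr (_ *: (f _ - _)).
  by rewrite [h *: 1]mulr1 mulrC -scalerA addrC.
case: H2; rewrite /derivable /derive /= E mulr0 scale0r addr0 mulrC => d2 D2.
by apply: DeriveDef.
Qed.

Lemma mvt_bound f x v (h c e : R) : 0 <= h ->
  (forall t, 0 <= t <= h -> derivable f (x + t *: v) v) ->
  (forall t, 0 <= t <= h -> `|'D_v f (x + t *: v) - c| <= e) ->
  `|f (x + h *: v) - f x - h * c| <= e * h.
Proof.
move=> h0 fd fe.
have H t : t \in `[0, h]%R -> is_derive t (1 : R) (fun s : R => f (x + s *: v)) ('D_v f (x + t *: v)).
  by rewrite in_itv/= => tI; apply: is_derive_line; exact: fd.
have [t tI] := @MVT_segment R (fun s => f (x + s *: v))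
  (fun s => 'D_v f (x + s *: v)) 0 h h0
  (fun t tI => H t (subset_itv_oo_cc tI))
  (derivable_within_continuous (fun t tI => @ex_derive _ _ _ _ _ _ _ (H t tI))).
rewrite scale0r addr0 subr0 => ->; rewrite [h * c]mulrC -mulrBl normrM (ger0_norm h0).
by apply: ler_wpM2r => //; apply: fe; move: tI; rewrite in_itv.
Qed.

Lemma near_square x v w (P : V -> Prop) : (\forall y \near x, P y) ->
  exists2 d : R, 0 < d & forall s t, 0 <= s <= d -> 0 <= t <= d ->
    P (x + s *: v + t *: w).
Proof.
move=> /nbhs_normP[e /= e0 He].
pose d := e / (2 * (`|v| + `|w| + 1)).
have N0 : 0 < `|v| + `|w| + 1 by rewrite ltr_wpDl// addr_ge0.
have d0 : 0 < d by rewrite divr_gt0// mulr_gt0.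
exists d => // s t /andP[s0 sd] /andP[t0 td]; apply: He.
rewrite /ball_/= -addrA opprD addNKr normrN.
apply: le_lt_trans (ler_normD _ _) _; rewrite !normrZ !ger0_norm//.
apply: (@le_lt_trans _ _ (d * (`|v| + `|w| + 1))).
  by rewrite !mulrDr mulr1 -[X in X <= _]addr0 !lerD ?(ltW d0)// ler_wpM2r.
by rewrite /d invfM mulrA mulfVK ?gt_eqF// ltr_pdivrMr// ltr_pMr// ltr1n.
Qed.

Lemma near_close A f x (e : R) : open A -> A x -> smooth_on A f -> 0 < e ->
  \forall y \near x, A y /\ `|f y - f x| <= e.
Proof.
move=> oA Ax fA e0; near=> y; split; first by near: y; exact: open_nbhs_nbhs.
rewrite distrC; near: y.
by have /cvgrPdist_le/(_ e e0) := smooth_on_continuous fA Ax.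
Unshelve. all: by end_near. Qed.

(** ['D_v] is only a directional derivative, so additivity in the direction rests on continuity of
    the derivatives. The increment along [v + w] is compared with the broken path through
    [x + d *: v]; each of the three segments costs at most [e / 3 * d]. *)
Lemma derive_dirD A f x v w : open A -> A x -> smooth_on A f ->
  'D_(v + w) f x = 'D_v f x + 'D_w f x.
Proof.
move=> oA Ax fA; apply/eqP; rewrite -subr_eq0 -normr_le0; apply/ler_addgt0Pl => e e0.
rewrite addr0.
have e30 : 0 < e / 3 by rewrite divr_gt0.
have N u : \forall y \near x, A y /\ `|'D_u f y - 'D_u f x| <= e / 3.
  exact: (near_close oA Ax (smooth_onD u fA) e30).
have [d d0 Hd] := near_square v w (filterI (N v) (filterI (N w) (N (v + w)))).
have dd : 0 <= d <= d by rewrite lexx ltW.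
have d00 : 0 <= (0 : R) <= d by rewrite lexx ltW.
have fd y u : A y -> derivable f y u by exact: smooth_on_derivable.
have B1 : `|f (x + d *: v) - f x - d * 'D_v f x| <= e / 3 * d.
  apply: (@mvt_bound f x v d _ (e / 3) (ltW d0)) => t tI; have [] := Hd t 0 tI d00;
    rewrite scale0r addr0 => -[At Bt] _; [exact: fd|exact: Bt].
have B2 : `|f (x + d *: v + d *: w) - f (x + d *: v) - d * 'D_w f x| <= e / 3 * d.
  apply: (@mvt_bound f (x + d *: v) w d _ (e / 3) (ltW d0)) => t tI;
    have [_ [[At Bt] _]] := Hd d t dd tI; [exact: fd|exact: Bt].
have B3 : `|f (x + d *: (v + w)) - f x - d * 'D_(v + w) f x| <= e / 3 * d.
  apply: (@mvt_bound f x (v + w) d _ (e / 3) (ltW d0)) => t tI;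
    have [_ [_]] := Hd t t tI tI;
    rewrite -addrA -scalerDr => -[At Bt]; [exact: fd|exact: Bt].
rewrite -(ler_pM2r d0).
have -> : e * d = e / 3 * d + e / 3 * d + e / 3 * d by field.
rewrite -{1}(gtr0_norm d0) -normrM.
have -> : ('D_(v + w) f x - ('D_v f x + 'D_w f x)) * d =
  (f (x + d *: v) - f x - d * 'D_v f x) +
  (f (x + d *: v + d *: w) - f (x + d *: v) - d * 'D_w f x) -
  (f (x + d *: (v + w)) - f x - d * 'D_(v + w) f x).
  by rewrite scalerDr [x + (d *: v + _)]addrA; ring.
apply: (le_trans (ler_normB _ _)); apply: lerD B3.
apply: (le_trans (ler_normD _ _)); exact: lerD B1 B2.
Qed.

Lemma schwarz_bound A f x v w (e : R) : open A -> A x -> smooth_on A f -> 0 < e ->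
  exists2 d : R, 0 < d & forall h, 0 < h <= d ->
    `|f (x + h *: v + h *: w) - f (x + h *: v) - f (x + h *: w) + f x
      - h * h * 'D_w ('D_v f) x| <= e * (h * h).
Proof.
move=> oA Ax fA e0.
have N : \forall y \near x, A y /\ `|'D_w ('D_v f) y - 'D_w ('D_v f) x| <= e.
  exact: (near_close oA Ax (smooth_onD w (smooth_onD v fA)) e0).
have [d d0 Hd] := near_square v w N.
exists d => // h /andP[h0 hd]; have h0' := ltW h0.
have hI t : 0 <= t <= h -> 0 <= t <= d by case/andP => -> /le_trans ->.
have fd y u : A y -> derivable f y u by exact: smooth_on_derivable.
have dh : 0 <= h <= d by rewrite h0'.
have d00 : 0 <= (0 : R) <= d by rewrite lexx ltW.
(* the second difference is a first difference of [s |-> f (s + h w) - f s] *)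
pose g y := f (y + h *: w) - f y.
have gd t : 0 <= t <= h -> is_derive (x + t *: v) v g
    ('D_v f (x + t *: v + h *: w) - 'D_v f (x + t *: v)).
  move=> /hI tI; have [A1 _] := Hd t h tI dh.
  have [] := Hd t 0 tI d00; rewrite scale0r addr0 => A2 _.
  have E1 : is_derive (x + t *: v) v (fun y => f (y + h *: w)) ('D_v f (x + t *: v + h *: w)).
    have := fd _ v A1; rewrite /derivable => D1.
    have E : (fun k : R => k^-1 *: (f (k *: v + (x + t *: v + h *: w)) - f (x + t *: v + h *: w))) =
       (fun k : R => k^-1 *: (f (k *: v + (x + t *: v) + h *: w) - f (x + t *: v + h *: w))).
      by apply/funext => k; rewrite addrA.
    by apply: DeriveDef; rewrite /derivable /derive /= -E.
  have E2 : is_derive (x + t *: v) v f ('D_v f (x + t *: v)) by apply: derivableP; exact: fd.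
  exact: is_deriveB.
have := @mvt_bound g x v h (h * 'D_w ('D_v f) x) (e * h) h0'
   (fun t tI => @ex_derive _ _ _ _ _ _ _ (gd t tI)).
have -> : g (x + h *: v) - g x - h * (h * 'D_w ('D_v f) x) =
  f (x + h *: v + h *: w) - f (x + h *: v) - f (x + h *: w) + f x - h * h * 'D_w ('D_v f) x.
  by rewrite /g; ring.
rewrite [e * (h * h)]mulrA; apply => t tI.
rewrite (@derive_val _ _ _ _ _ _ _ (gd t tI)).
apply: (@mvt_bound ('D_v f) (x + t *: v) w h _ e h0') => s sI;
  have [As Bs] := Hd t s (hI _ tI) (hI _ sI).
  exact: (smooth_on_derivable (smooth_onD v fA) As).
exact: Bs.
Qed.

(** The second difference over a small parallelogram does not change when [v] and [w] are exchanged,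
    and [h * h] times either mixed derivative approximates it. *)
Lemma deriveC A f x v w : open A -> A x -> smooth_on A f ->
  'D_v ('D_w f) x = 'D_w ('D_v f) x.
Proof.
move=> oA Ax fA; apply/eqP; rewrite -subr_eq0 -normr_le0; apply/ler_addgt0Pl => e e0.
rewrite addr0.
have e20 : 0 < e / 2 by rewrite divr_gt0.
have [d d0 Hd] := schwarz_bound v w oA Ax fA e20.
have [d' d'0 Hd'] := schwarz_bound w v oA Ax fA e20.
have [h [h0 hd hd']] : exists h : R, [/\ 0 < h, h <= d & h <= d'].
  by exists (Num.min d d'); rewrite lt_min d0 d'0 !ge_min !lexx orbT.
have h20 : 0 < h * h by rewrite mulr_gt0.
have := Hd h; have := Hd' h; rewrite h0 hd hd' => /(_ isT) H' /(_ isT) H.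
rewrite -(ler_pM2r h20) -{1}(gtr0_norm h20) -normrM.
move: H'; rewrite [x + h *: w + h *: v]addrAC => H'; move: H H'.
move: ('D_v ('D_w f) x) ('D_w ('D_v f) x) (f (x + h *: v + h *: w)) (f (x + h *: v))
  (f (x + h *: w)) (f x) => a b p q r s H H'.
have -> : (a - b) * (h * h) =
  (p - q - r + s - h * h * b) - (p - r - q + s - h * h * a) by ring.
have -> : e * (h * h) = e / 2 * (h * h) + e / 2 * (h * h) by field.
apply: (le_trans (ler_normB _ _)); exact: lerD.
Qed.

Lemma derive_dir_sum A f x (I : Type) (s : seq I) (v : I -> V) : open A -> A x -> smooth_on A f ->
  'D_(\sum_(i <- s) v i) f x = \sum_(i <- s) 'D_(v i) f x.
Proof.
move=> oA Ax fA; elim: s => [|i s IH]; first by rewrite !big_nil derive0.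
by rewrite !big_cons (derive_dirD _ _ oA Ax fA) IH.
Qed.

End DirectionalDerivatives.

(** * Hessians whose derivative is divisible by them *)

Section CubicForm.
Context {R : realType} {V : normedModType R}.
Variables (U : set V) (v w : V).
Hypothesis oU : open U.

Lemma derive_bilin2 (x u : V) (c1 c2 : R) (f1 g1 f2 g2 h : V -> R) : U x ->
  smooth_on U f1 -> smooth_on U g1 -> smooth_on U f2 -> smooth_on U g2 ->
  (forall y, U y -> h y = c1 * (f1 y * g1 y) + c2 * (f2 y * g2 y)) ->
  'D_u h x = c1 * ('D_u f1 x * g1 x + f1 x * 'D_u g1 x)
           + c2 * ('D_u f2 x * g2 x + f2 x * 'D_u g2 x).
Proof.
move=> Ux sf1 sg1 sf2 sg2 Hh; rewrite (eq_derive_on u oU Ux Hh).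
have s1 := smooth_on_mul oU sf1 sg1; have s2 := smooth_on_mul oU sf2 sg2.
rewrite (derive_add Ux u (smooth_on_mul oU (smooth_on_cst c1) s1)
  (smooth_on_mul oU (smooth_on_cst c2) s2)).
rewrite (derive_mulc Ux c1 u s1) (derive_mulc Ux c2 u s2).
by rewrite (derive_mul Ux u sf1 sg1) (derive_mul Ux u sf2 sg2).
Qed.

(** [E], [B], [D] are the entries of the Hessian, [K] and [M] the components of kappa, [kv] to [mw]
    the derivatives of the latter. The premises say that mixed derivatives of the entries commute.
    As the determinant is nonzero, the derivative of kappa minus kappa kappa must be a multiple of
    the Hessian; the factor is read off in the direction [v]. *)
Lemma cubic_hessian_aux (E B D K M kv kw mv mw : R) : E != 0 -> E * D - B ^+ 2 != 0 ->
  3 * (kw * E + K * (2 * (K * B) + M * E)) =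
    2 * (kv * B + K * (2 * (K * B) + M * E)) + (mv * E + M * (3 * (K * E))) ->
  2 * (kw * B + K * (K * D + 2 * (M * B))) + (mw * E + M * (2 * (K * B) + M * E)) =
    (kv * D + K * (K * D + 2 * (M * B))) + 2 * (mv * B + M * (2 * (K * B) + M * E)) ->
  (kw * D + K * (3 * (M * D))) + 2 * (mw * B + M * (K * D + 2 * (M * B))) =
    3 * (mv * D + M * (K * D + 2 * (M * B))) ->
  [/\ kw = K * M + (kv - K ^+ 2) / E * B, mv = K * M + (kv - K ^+ 2) / E * B &
      mw = M * M + (kv - K ^+ 2) / E * D].
Proof.
move=> E0 De0 H1 H2 H3.
(* In terms of P = D kappa - kappa kappa the three equations are linear. *)
pose Pvv := kv - K ^+ 2; pose Pvw := kw - K * M; pose Pwv := mv - K * M; pose Pww := mw - M * M.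
have G1 : 3 * (Pvw * E) = 2 * (Pvv * B) + Pwv * E by rewrite /Pvw /Pvv /Pwv; lra.
have G2 : 2 * (Pvw * B) + Pww * E = Pvv * D + 2 * (Pwv * B) by rewrite /Pvw /Pvv /Pwv /Pww; lra.
have G3 : 3 * (Pwv * D) = 2 * (Pww * B) + Pvw * D by rewrite /Pvw /Pww /Pwv; lra.
suff [Q1 Q2 Q3] : [/\ Pvw = Pvv / E * B, Pwv = Pvv / E * B & Pww = Pvv / E * D].
  by rewrite -/Pvv -Q1 -Q3 {2}Q1 -Q2 /Pvw /Pwv /Pww; split; ring.
move: Pvv Pvw Pwv Pww G1 G2 G3 => a p q c G1 G2 G3 {H1 H2 H3}.
have X0 : a * D = c * E.
  apply: (mulfI De0).
  have := congr1 ( *%R (D * B)) G1; have := congr1 ( *%R (E * B)) G3.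
  have := congr1 ( *%R (E * D)) G2; have := congr1 ( *%R (B * B)) G2; lra.
have pq : p = q.
  apply: (mulfI De0).
  have := congr1 ( *%R D) G1; have := congr1 ( *%R B) G2; have := congr1 ( *%R E) G3.
  have := congr1 ( *%R B) X0; lra.
split; rewrite -?pq; apply: (mulfI E0).
- have -> : E * (a / E * B) = a * B by field.
  by move: G1; rewrite -pq; lra.
- have -> : E * (a / E * B) = a * B by field.
  by move: G1; rewrite -pq; lra.
- have -> : E * (a / E * D) = a * D by field.
  by rewrite X0 mulrC.
Qed.

(** Next integrability condition: mixed derivatives of kappa commute. For the covector X = dP - P
    kappa the premises reduce to X_w E = X_v B and X_v D = X_w B, so X vanishes because the Hessian
    is nondegenerate. *)
Lemma cubic_gradient_aux (E B D K M P pv pw : R) : E * D - B ^+ 2 != 0 ->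
  (K * K + P * E) * M + K * (K * M + P * B) + (pv * B + P * (2 * (K * B) + M * E)) =
    (K * M + P * B) * K + K * (K * M + P * B) + (pw * E + P * (2 * (K * B) + M * E)) ->
  (K * M + P * B) * M + M * (K * M + P * B) + (pv * D + P * (K * D + 2 * (M * B))) =
    (K * M + P * B) * M + K * (M * M + P * D) + (pw * B + P * (K * D + 2 * (M * B))) ->
  pv = P * K.
Proof.
move=> De0 H1 H2.
have G1 : (pw - P * M) * E = (pv - P * K) * B by lra.
have G2 : (pv - P * K) * D = (pw - P * M) * B by lra.
apply/eqP; rewrite -subr_eq0; apply/eqP; apply: (mulfI De0); rewrite mulr0.
have -> : (E * D - B ^+ 2) * (pv - P * K) =
  E * ((pv - P * K) * D) - B * ((pv - P * K) * B) by ring.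
by rewrite G2 -G1; ring.
Qed.

(** In the application these are F_vv, F_vw, F_ww, kappa_v and kappa_w, and the hypotheses state
    that F_jkl is the symmetrisation of kappa_j F_kl in the directions [v] and [w]. *)
Variables e b d k m : V -> R.
Hypotheses (se : smooth_on U e) (sb : smooth_on U b) (sd : smooth_on U d)
  (sk : smooth_on U k) (sm : smooth_on U m).
Hypotheses (e0 : forall x, U x -> e x != 0)
  (delta0 : forall x, U x -> e x * d x - b x ^+ 2 != 0).
Hypotheses (ev : forall x, U x -> 'D_v e x = 3 * (k x * e x))
  (ew : forall x, U x -> 'D_w e x = 2 * (k x * b x) + m x * e x)
  (bv : forall x, U x -> 'D_v b x = 2 * (k x * b x) + m x * e x)
  (bw : forall x, U x -> 'D_w b x = k x * d x + 2 * (m x * b x))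
  (dv : forall x, U x -> 'D_v d x = k x * d x + 2 * (m x * b x))
  (dw : forall x, U x -> 'D_w d x = 3 * (m x * d x)).

Let p (x : V) : R := ('D_v k x - k x ^+ 2) / e x.

Let sp : smooth_on U p.
Proof.
apply: (smooth_on_mul oU); last exact: (smooth_on_inv oU).
apply: (smooth_on_sub oU); first exact: (smooth_onD v sk).
exact: (smooth_on_exp _ oU).
Qed.

Lemma derive_kappa x : U x ->
  [/\ 'D_v k x = k x * k x + p x * e x, 'D_w k x = k x * m x + p x * b x,
      'D_v m x = k x * m x + p x * b x & 'D_w m x = m x * m x + p x * d x].
Proof.
move=> Ux.
have B21 u h f1 g1 f2 g2 := @derive_bilin2 x u 2 1 f1 g1 f2 g2 h Ux.
have B12 u h f1 g1 f2 g2 := @derive_bilin2 x u 1 2 f1 g1 f2 g2 h Ux.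
have B30 u h f1 g1 := @derive_bilin2 x u 3 0 f1 g1 f1 g1 h Ux.
have e_vw := B21 v ('D_w e) k b m e sk sb sm se.
have e_wv := B30 w ('D_v e) k e sk se sk se.
have b_wv := B21 w ('D_v b) k b m e sk sb sm se.
have b_vw := B12 v ('D_w b) k d m b sk sd sm sb.
have d_wv := B12 w ('D_v d) k d m b sk sd sm sb.
have d_vw := B30 v ('D_w d) m d sm sd sm sd.
move: (deriveC v w oU Ux se) (deriveC v w oU Ux sb) (deriveC v w oU Ux sd).
rewrite e_vw; last by move=> y Uy; rewrite ew// mul1r.
rewrite e_wv; last by move=> y Uy; rewrite ev// mul0r addr0.
rewrite b_vw; last by move=> y Uy; rewrite bw// mul1r.
rewrite b_wv; last by move=> y Uy; rewrite bv// mul1r.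
rewrite d_wv; last by move=> y Uy; rewrite dv// mul1r.
rewrite d_vw; last by move=> y Uy; rewrite dw// mul0r addr0.
rewrite (ev Ux) (ew Ux) (bv Ux) (bw Ux) (dv Ux) (dw Ux) !mul1r !mul0r !addr0 => H1 H2 H3.
have [Q1 Q2 Q3] := @cubic_hessian_aux (e x) (b x) (d x) (k x) (m x) ('D_v k x) ('D_w k x)
  ('D_v m x) ('D_w m x) (e0 Ux) (delta0 Ux) (esym H1) (esym H2) (esym H3).
split => //; rewrite /p divfK ?e0//; ring.
Qed.

(** Because e' = 3 k e, the third derivative of e^(-2/3) along [v] is -2 (k'' - 6 k k' + 4 k^3)
    e^(-2/3), so this is Halphen's equation in terms of kappa. It comes from k' = k^2 + p e and p' =
    p k by eliminating p. *)
Lemma derive_kappa2 x : U x -> 'D_v ('D_v k) x = 6 * (k x * 'D_v k x) - 4 * k x ^+ 3.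
Proof.
move=> Ux.
have B11 u h f1 g1 f2 g2 := @derive_bilin2 x u 1 1 f1 g1 f2 g2 h Ux.
have K y (Uy : U y) := derive_kappa Uy.
have k_vv := B11 v ('D_v k) k k p e sk sk sp se.
have k_wv := B11 w ('D_v k) k k p e sk sk sp se.
have k_vw := B11 v ('D_w k) k m p b sk sm sp sb.
have m_wv := B11 w ('D_v m) k m p b sk sm sp sb.
have m_vw := B11 v ('D_w m) m m p d sm sm sp sd.
have kvE y : U y -> 'D_v k y = 1 * (k y * k y) + 1 * (p y * e y).
  by move=> /K[-> _ _ _]; rewrite !mul1r.
have kwE y : U y -> 'D_w k y = 1 * (k y * m y) + 1 * (p y * b y).
  by move=> /K[_ -> _ _]; rewrite !mul1r.
have mvE y : U y -> 'D_v m y = 1 * (k y * m y) + 1 * (p y * b y).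
  by move=> /K[_ _ -> _]; rewrite !mul1r.
have mwE y : U y -> 'D_w m y = 1 * (m y * m y) + 1 * (p y * d y).
  by move=> /K[_ _ _ ->]; rewrite !mul1r.
move: (k_vv kvE) (deriveC v w oU Ux sk) (deriveC v w oU Ux sm).
rewrite (k_wv kvE) (k_vw kwE) (m_wv mvE) (m_vw mwE) => ->.
have [-> -> -> ->] := K x Ux; rewrite !mul1r.
rewrite (ev Ux) (ew Ux) (bv Ux) (bw Ux) (dv Ux).
move=> H1 H2; rewrite (cubic_gradient_aux (delta0 Ux) H1 H2).
by move: (e x) (k x) (p x) => E k1 P; ring.
Qed.

(* Halphen's equation of the conics, for f'' = e along the direction v. *)
Lemma monge_of_cubic x : U x ->
  9 * e x ^+ 2 * 'D_v ('D_v ('D_v e)) x - 45 * e x * 'D_v e x * 'D_v ('D_v e) x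
  + 40 * 'D_v e x ^+ 3 = 0.
Proof.
move=> Ux.
have B30 h f1 g1 y Uy := @derive_bilin2 y v 3 0 f1 g1 f1 g1 h Uy.
have D2 y : U y -> 'D_v ('D_v e) y = 3 * ('D_v k y * e y) + 9 * (k y * (k y * e y)).
  move=> Uy; rewrite (B30 _ k e y Uy)//; last by move=> z Uz; rewrite ev// mul0r addr0.
  by rewrite ev//; ring.
have ske := smooth_on_mul oU sk se.
have skv := smooth_onD v sk.
rewrite (@derive_bilin2 x v 3 9 ('D_v k) e k (fun y => k y * e y) _ Ux skv se sk ske D2).
rewrite (derive_mul Ux v sk se) D2// derive_kappa2// !ev//.
by move: (e x) (k x) ('D_v k x) => E K kv; ring.
Qed.

End CubicForm.

(** * Halphen's equation on the real line *)

Section OneVariable.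
Context {R : realType}.
Implicit Types f g : R -> R.

Lemma is_derive1_add f g (t f' g' : R) : is_derive t 1 f f' -> is_derive t 1 g g' ->
  is_derive t 1 (fun s => f s + g s) (f' + g').
Proof. by move=> df dg; exact: is_deriveD. Qed.

Lemma is_derive1_mul f g (t f' g' : R) : is_derive t 1 f f' -> is_derive t 1 g g' ->
  is_derive t 1 (fun s => f s * g s) (f' * g t + f t * g').
Proof.
move=> df dg; apply: (is_derive_eq (is_deriveM df dg)).
by rewrite /GRing.scale/= addrC mulrC.
Qed.

Lemma is_derive1_mulc f (c t f' : R) : is_derive t 1 f f' ->
  is_derive t 1 (fun s => c * f s) (c * f').
Proof.
move=> df; apply: (is_derive_eq (is_derive1_mul (is_derive_cst c t 1) df)).
by rewrite mul0r add0r.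
Qed.

Lemma is_derive1_powR_fun f (a t f' : R) : 0 < f t -> is_derive t 1 f f' ->
  is_derive t 1 (fun s => f s `^ a) (a * f t `^ (a - 1) * f').
Proof.
move=> f0 df; exact: (@is_derive1_comp _ (fun x => x `^ a) f _ _ _ (is_derive1_powR a f0) df).
Qed.

Lemma is_derive1_poly2 (q0 q1 q2 t : R) :
  is_derive t 1 (fun s => q0 + q1 * s + q2 * s ^+ 2) (q1 + 2 * q2 * t).
Proof.
have d1 := is_derive_id t (1 : R).
apply: (is_derive_eq (is_derive1_add (is_derive1_add (is_derive_cst q0 t 1)
  (is_derive1_mulc q1 d1)) (is_derive1_mulc q2 (is_derive1_mul d1 d1)))).
by rewrite /=; ring.
Qed.

Lemma derive1_const f g (c : R) : (forall t : R, is_derive t 1 f (g t)) ->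
  (forall t, g t = c) -> forall t, f t = f 0 + c * t.
Proof.
move=> df gc t.
have H s : is_derive s (1 : R) (fun s => f s + - c * s) 0.
  apply: (is_derive_eq (is_derive1_add (df s) (is_derive1_mulc (- c) (is_derive_id s (1 : R))))).
  by rewrite gc; ring.
have := is_derive_0_is_cst t 0 H; rewrite mulr0 addr0 => <-; ring.
Qed.

Lemma derive3_eq0_poly2 g0 g1 g2 : (forall t : R, is_derive t 1 g0 (g1 t)) ->
  (forall t : R, is_derive t 1 g1 (g2 t)) -> (forall t : R, is_derive t 1 g2 0) ->
  exists q0 q1 q2, forall t, g0 t = q0 + q1 * t + q2 * t ^+ 2.
Proof.
move=> d0 d1 d2.
have E2 t : g2 t = g2 0 by exact: is_derive_0_is_cst.
have E1 := derive1_const d1 E2.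
exists (g0 0), (g1 0), (g2 0 / 2) => t.
have H s : is_derive s (1 : R) (fun s => g0 s + - (0 + g1 0 * s + g2 0 / 2 * s ^+ 2)) 0.
  have dq := is_derive1_mulc (- 1) (is_derive1_poly2 0 (g1 0) (g2 0 / 2) s).
  have := is_derive1_add (d0 s) dq.
  have -> : (fun s => g0 s + -1 * (0 + g1 0 * s + g2 0 / 2 * s ^+ 2)) =
     (fun s => g0 s + - (0 + g1 0 * s + g2 0 / 2 * s ^+ 2)).
    by apply/funext => r; rewrite mulN1r.
  by move=> H; apply: (is_derive_eq H); rewrite E1; field.
have := is_derive_0_is_cst t 0 H; rewrite mulr0 expr0n/= mulr0 !addr0 oppr0 addr0 => <-; ring.
Qed.

Lemma powR_succ (x a : R) : 0 < x -> x `^ (a + 1) = x `^ a * x.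
Proof. by move=> x0; rewrite powRD ?powRr1 ?(ltW x0) ?(gt_eqF x0) ?implybT. Qed.

(** [x], [y], [z], [u] are f'' and its next three derivatives, and [P] is f''^(a - 3); the left side
    of the conclusion is the third derivative of f''^a as the product rule delivers it. The factor
    [- (2 / 27)] is [a / 9]. *)
Let halphen_third (P x y z u : R) (a := - (2 / 3) : R) :
  9 * x ^+ 2 * u - 45 * x * y * z + 40 * y ^+ 3 = 0 ->
  a * (((a - 1) * ((a - 1 - 1) * P * y) * y + (a - 1) * (P * x) * z) * y
       + (a - 1) * (P * x) * y * z
       + ((a - 1) * (P * x) * y * z + P * x * x * u)) = 0.
Proof.
move=> M.
transitivity (- (2 / 27) * P * (9 * x ^+ 2 * u - 45 * x * y * z + 40 * y ^+ 3)).
  by rewrite /a; field.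
by rewrite M mulr0.
Qed.

(** For q = q0 + q1 t + q2 t^2 the expression 2 q q'' - q'^2 is the constant 4 D, whence (sqrt q)''
    = D q^(-3/2). Here [y] stands for q^(-3/2). *)
Let sqrt_poly2_second (q0 q1 q2 y t : R) (D := q0 * q2 - q1 ^+ 2 / 4) : D != 0 ->
  y + - (2 * D)^-1 * ((2^-1 - 1) * y * (q1 + 2 * q2 * t) * (q1 + 2 * q2 * t)
     + y * (q0 + q1 * t + q2 * t ^+ 2) * (2 * q2)) = 0.
Proof.
move=> Dn0; apply: (mulfI Dn0).
have -> : - (2 * D)^-1 = - (2^-1) * D^-1 by rewrite invfM mulNr.
rewrite mulrDr -!mulrA mulrCA [D * (D^-1 * _)]mulVKf// mulr0 /D.
by field.
Qed.

(* Up to the factor f2^(a - 3) the third derivative of f2^a, a = -2/3, is Halphen's operator. *)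
Lemma monge_powR_poly2 f2 f3 f4 f5 :
  (forall t : R, is_derive t 1 f2 (f3 t)) -> (forall t : R, is_derive t 1 f3 (f4 t)) ->
  (forall t : R, is_derive t 1 f4 (f5 t)) -> (forall t, 0 < f2 t) ->
  (forall t, 9 * f2 t ^+ 2 * f5 t - 45 * f2 t * f3 t * f4 t + 40 * f3 t ^+ 3 = 0) ->
  exists q0 q1 q2, forall t, f2 t `^ (- (2 / 3)) = q0 + q1 * t + q2 * t ^+ 2.
Proof.
move=> d2 d3 d4 f2_gt0 monge.
pose a : R := - (2 / 3).
have P1 t b := is_derive1_powR_fun b (f2_gt0 t) (d2 t).
have D1 t : is_derive t (1 : R) (fun s => f2 s `^ a) (a * (f2 t `^ (a - 1) * f3 t)).
  by apply: (is_derive_eq (P1 t a)); rewrite mulrA.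
have D2 t := is_derive1_mulc a (is_derive1_mul (P1 t (a - 1)) (d3 t)).
have D3 t := is_derive1_mulc a (is_derive1_add
  (is_derive1_mul (is_derive1_mul (is_derive1_mulc (a - 1) (P1 t (a - 1 - 1))) (d3 t)) (d3 t))
  (is_derive1_mul (P1 t (a - 1)) (d4 t))).
apply: (derive3_eq0_poly2 D1 D2) => t.
apply: (is_derive_eq (D3 t)).
have E1 : f2 t `^ (a - 1 - 1) = f2 t `^ (a - 1 - 1 - 1) * f2 t.
  by rewrite -powR_succ// subrK.
have E2 : f2 t `^ (a - 1) = f2 t `^ (a - 1 - 1 - 1) * f2 t * f2 t.
  by rewrite -E1 -powR_succ// subrK.
rewrite E2 E1; move: (monge t).
exact: halphen_third.
Qed.

(** The premise says f'' = q^(-3/2), and sqrt q / D has the same second derivative, so the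
    difference is affine. Positivity of q on the whole line is what makes D positive; a q with a
    double root would give D = 0. *)
Lemma derive2_poly2_powR f0 f1 f2 (q0 q1 q2 : R) :
  (forall t : R, is_derive t 1 f0 (f1 t)) -> (forall t : R, is_derive t 1 f1 (f2 t)) ->
  (forall t, 0 < f2 t) ->
  (forall t, f2 t `^ (- (2 / 3)) = q0 + q1 * t + q2 * t ^+ 2) ->
  0 < q2 ->
  0 < q0 * q2 - q1 ^+ 2 / 4 /\
  exists A B, forall t, f0 t =
    Num.sqrt (q0 + q1 * t + q2 * t ^+ 2) / (q0 * q2 - q1 ^+ 2 / 4) + A + B * t.
Proof.
move=> d0 d1 f2_gt0 Q q2_gt0.
have Q0 t : 0 < q0 + q1 * t + q2 * t ^+ 2 by rewrite -Q powR_gt0.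
pose D := q0 * q2 - q1 ^+ 2 / 4.
have D0 : 0 < D.
  (* The vertex of the parabola, where q takes the value D / q2. *)
  have := Q0 (- q1 / (2 * q2)).
  have -> : q0 + q1 * (- q1 / (2 * q2)) + q2 * (- q1 / (2 * q2)) ^+ 2 = D / q2.
    by rewrite /D; field; rewrite gt_eqF.
  by rewrite pmulr_lgt0// invr_gt0.
split => //.
pose q (t : R) := q0 + q1 * t + q2 * t ^+ 2.
have P1 t b := @is_derive1_powR_fun (fun s => q0 + q1 * s + q2 * s ^+ 2) b t _ (Q0 t)
  (is_derive1_poly2 q0 q1 q2 t).
have Pt t : is_derive t (1 : R) (fun s => q1 + 2 * q2 * s) (2 * q2).
  apply: (is_derive_eq (is_derive1_add (is_derive_cst q1 t (1 : R))
    (is_derive1_mulc (2 * q2) (is_derive_id t (1 : R))))).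
  by rewrite mulr1 add0r.
have H1 t : is_derive t (1 : R) (fun s => f0 s + - D^-1 * q s `^ (2^-1))
    (f1 t + - (2 * D)^-1 * (q t `^ (2^-1 - 1) * (q1 + 2 * q2 * t))).
  apply: (is_derive_eq (is_derive1_add (d0 t) (is_derive1_mulc (- D^-1) (P1 t 2^-1)))).
  by rewrite invfM /q; congr (_ + _); rewrite !mulNr -!mulrA mulrCA.
have H2 t : is_derive t (1 : R)
    (fun s => f1 s + - (2 * D)^-1 * (q s `^ (2^-1 - 1) * (q1 + 2 * q2 * s))) 0.
  apply: (is_derive_eq (is_derive1_add (d1 t) (is_derive1_mulc (- (2 * D)^-1)
     (is_derive1_mul (P1 t (2^-1 - 1)) (Pt t))))).
  have E1 : q t `^ (2^-1 - 1) = q t `^ (2^-1 - 1 - 1) * q t.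
    by rewrite -powR_succ ?subrK// Q0.
  have E2 : q t `^ (2^-1 - 1 - 1) = f2 t.
    rewrite /q -Q -powRrM; have -> : - (2 / 3) * (2^-1 - 1 - 1) = 1 :> R by field.
    by rewrite powRr1// ltW.
  rewrite -/(q t) E1 E2.
  by apply: sqrt_poly2_second; rewrite gt_eqF.
have E1 t := is_derive_0_is_cst t 0 H2.
pose B := f1 0 + - (2 * D)^-1 * (q 0 `^ (2^-1 - 1) * (q1 + 2 * q2 * 0)).
pose A := f0 0 + - D^-1 * q 0 `^ (2^-1).
exists A, B => t.
have := derive1_const H1 E1 t; rewrite -/A -/B => E0.
rewrite -[f0 t](addrK (- D^-1 * q t `^ (2^-1))) E0 /q powR12_sqrt ?(ltW (Q0 t))//.
by rewrite -/D; ring.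
Qed.
End OneVariable.

(** * Splitting a Minkowski norm into even and odd parts *)

Section MinkowskiNorm.
Context {R : realType} {E : lmodType R}.
Implicit Types (u v y : E).

Definition indep u v := forall a b : R, a *: u + b *: v = 0 -> a = 0 /\ b = 0.

Lemma indepC u v : indep u v -> indep v u.
Proof. by move=> uv a b; rewrite addrC => /uv[]. Qed.

Lemma indep_comb u v (a b c d : R) : a * d - b * c != 0 -> indep u v ->
  indep (a *: u + b *: v) (c *: u + d *: v).
Proof.
move=> D0 uv p q; rewrite !scalerDr !scalerA addrACA -!scalerDl => /uv[H1 H2].
split; apply: (mulfI D0); rewrite mulr0.
  by transitivity (d * (p * a + q * c) - c * (p * b + q * d)); [ring|rewrite H1 H2; ring].
by transitivity (a * (p * b + q * d) - b * (p * a + q * c)); [ring|rewrite H1 H2; ring].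
Qed.

Lemma indep_line u v (t : R) : indep u v -> indep (u + t *: v) v.
Proof.
move=> uv; have := @indep_comb u v 1 t 0 1; rewrite !scale1r scale0r add0r.
by apply => //; rewrite mulr0 subr0 mulr1 oner_neq0.
Qed.

Lemma indep_neq0 u v (a b : R) : indep u v -> (a != 0) || (b != 0) -> a *: u + b *: v != 0.
Proof. by move=> uv; apply: contraTneq => /uv[-> ->]; rewrite eqxx. Qed.

Lemma indepNN u v : indep u v -> indep (- u) (- v).
Proof.
move=> uv; have := @indep_comb u v (-1) 0 0 (-1).
by rewrite !scaleN1r !scale0r add0r addr0; apply => //; rewrite mulr0 subr0 mulrNN mulr1 oner_neq0.
Qed.

(* h v y stands for the second derivative of N at y in the direction v. *)
Variables (N : E -> R) (h : E -> E -> R).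
Hypothesis N_hom : forall y (t : R), 0 < t -> N (t *: y) = t * N y.
Hypothesis h_hom : forall v y (t : R), y != 0 -> 0 < t -> h v (t *: y) = t^-1 * h v y.
Hypothesis h_opp : forall v y, y != 0 -> h (- v) y = h v y.
Hypothesis h_swap : forall u v (a b : R), a *: u + b *: v != 0 ->
  a ^+ 2 * h u (a *: u + b *: v) = b ^+ 2 * h v (a *: u + b *: v).
Hypothesis h_gt0 : forall u v, indep u v -> 0 < h u v.
Hypothesis N_line : forall u v, indep u v ->
  exists f1 f3 f4 f5 : R -> R,
  [/\ forall t : R, is_derive t 1 (fun s => N (u + s *: v)) (f1 t),
      forall t : R, is_derive t 1 f1 (h v (u + t *: v)),
      forall t : R, is_derive t 1 (fun s => h v (u + s *: v)) (f3 t),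
      (forall t : R, is_derive t 1 f3 (f4 t)) /\ (forall t : R, is_derive t 1 f4 (f5 t)) &
      forall t : R, 9 * h v (u + t *: v) ^+ 2 * f5 t
        - 45 * h v (u + t *: v) * f3 t * f4 t + 40 * f3 t ^+ 3 = 0].

Let pw (x : R) := x `^ (- (2 / 3)).

Let pw_inj (x y : R) : 0 < x -> 0 < y -> pw x = pw y -> x = y.
Proof.
move=> x0 y0 /(congr1 (fun z => z `^ (- (3 / 2)))); rewrite /pw -!powRrM.
have -> : - (2 / 3) * - (3 / 2) = 1 :> R by field.
by rewrite !powRr1 ?ltW.
Qed.

(** The cube is the factor between the Hessians at proportional points of the lines u + R v and v +
    R u: one power from homogeneity of degree -1, two from [h_swap]. *)
Let pw_cube (s x : R) : 0 < s -> 0 < x -> pw (s ^+ 3 * x) = s ^- 2 * pw x.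
Proof.
move=> s0 x0; rewrite /pw powRM ?exprn_ge0 ?(ltW s0) ?(ltW x0)//; congr (_ * _).
rewrite -powR_mulrn ?ltW// -powRrM.
have -> : 3%:R * - (2 / 3) = - 2%:R :> R by field.
by rewrite powR_invn// ltW.
Qed.

Lemma hess_poly2 u v : indep u v -> exists q0 q1 q2 : R,
  [/\ 0 < q2, forall t, pw (h v (u + t *: v)) = q0 + q1 * t + q2 * t ^+ 2 &
      forall s, pw (h u (v + s *: u)) = q2 + q1 * s + q0 * s ^+ 2].
Proof.
move=> uv; have vu := indepC uv.
have [f1 [f3 [f4 [f5 [d0 d1 d2 [d3 d4] M]]]]] := N_line uv.
have h0 t : 0 < h v (u + t *: v) by apply/h_gt0/indepC/indep_line.
have [q0 [q1 [q2 Q]]] := monge_powR_poly2 d2 d3 d4 h0 M.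
have [g1 [g3 [g4 [g5 [e0 e1 e2 [e3 e4] M']]]]] := N_line vu.
have h0' t : 0 < h u (v + t *: u) by apply/h_gt0/indepC/indep_line.
have [n0 [n1 [n2 P]]] := monge_powR_poly2 e2 e3 e4 h0' M'.
exists q0, q1, q2.
have key s : 0 < s -> n0 + n1 * s + n2 * s ^+ 2 = q2 + q1 * s + q0 * s ^+ 2.
  move=> s0; have sn0 : s != 0 by rewrite gt_eqF.
  have y0 : s *: u + 1 *: v != 0 by rewrite indep_neq0// sn0.
  have y1 : v + s *: u = s *: u + 1 *: v by rewrite scale1r addrC.
  have y2 : u + s^-1 *: v = s^-1 *: (s *: u + 1 *: v).
    by rewrite scalerDr !scalerA mulVf// mulr1 scale1r.
  have E1 : h v (u + s^-1 *: v) = s ^+ 3 * h u (v + s *: u).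
    rewrite y2 h_hom ?invr_gt0// invrK y1.
    have := h_swap y0; rewrite expr1n mul1r => <-; ring.
  rewrite -P; have := Q s^-1; rewrite E1 -/(pw _) pw_cube// => H.
  have : s ^+ 2 * (s ^- 2 * pw (h u (v + s *: u))) = s ^+ 2 * (q0 + q1 * s^-1 + q2 * s^-1 ^+ 2).
    by rewrite H.
  rewrite mulrA mulfV ?expf_neq0// mul1r /pw => ->.
  by field.
have k1 := key 1 ltr01; have k2 := key 2 (ltr0Sn _ _); have k3 := key 3 (ltr0Sn _ _).
have [E0 [E1 E2]] : n0 = q2 /\ n1 = q1 /\ n2 = q0 by split; [|split]; lra.
split => [||s]; last by rewrite /pw P E0 E1 E2.
  rewrite -E0; have := P 0; rewrite mulr0 expr0n mulr0 !addr0 => <-.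
  by rewrite powR_gt0.
by [].
Qed.

(** With v = y + u, the points y = v - u and -y = u - v have parameter -1 on v + R u and u + R v,
    where a quadratic polynomial and its reversal agree. [h_swap] exchanges the directions u and v
    at -y. *)
Lemma hess_even u y : indep u y -> h u (- y) = h u y.
Proof.
move=> uy; pose v := y + u.
have uv : indep u v.
  have := @indep_comb u y 1 0 1 1; rewrite !scale1r scale0r addr0 [u + y]addrC.
  by apply => //; rewrite mul0r subr0 mulr1 oner_neq0.
have [q0 [q1 [q2 [_ Q P]]]] := hess_poly2 uv.
have Ey : y = v + (-1) *: u by rewrite /v scaleN1r addrK.
have Ey' : - y = u + (-1) *: v by rewrite /v scaleN1r opprD addrCA subrr addr0.
have y0 : 1 *: u + (-1) *: v != 0 by rewrite indep_neq0// oner_neq0.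
have := h_swap y0; rewrite scale1r -Ey' expr1n sqrrN expr1n !mul1r => E1.
have uNy : indep u (- y).
  have := @indep_comb u y 1 0 0 (-1); rewrite !scale1r !scale0r addr0 add0r scaleN1r.
  by apply => //; rewrite mul0r subr0 mul1r oppr_eq0 oner_neq0.
apply: pw_inj; try exact: h_gt0.
rewrite E1; have := Q (-1); have := P (-1); rewrite -Ey -Ey' => -> ->; ring.
Qed.

(* For a Randers norm N = alpha + beta these are beta and alpha. *)
Definition odd_part y : R := (N y - N (- y)) / 2.
Definition even_part y : R := (N y + N (- y)) / 2.

Let N0 : N 0 = 0.
Proof. by have := @N_hom 0 2 (ltr0Sn _ _); rewrite scaler0; lra. Qed.

Lemma odd_partN y : odd_part (- y) = - odd_part y.
Proof. by rewrite /odd_part opprK; field. Qed.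

Lemma even_partN y : even_part (- y) = even_part y.
Proof. by rewrite /even_part opprK; field. Qed.

Lemma odd_part_hom y (t : R) : odd_part (t *: y) = t * odd_part y.
Proof.
have [t0|t0|->] := ltgtP t 0; last by rewrite scale0r /odd_part oppr0 N0 mul0r subrr mul0r.
  have nt : 0 < - t by rewrite oppr_gt0.
  by rewrite -[t]opprK scaleNr odd_partN /odd_part -scalerN !(N_hom _ nt); field.
by rewrite /odd_part -scalerN !(N_hom _ t0); field.
Qed.

Lemma even_part_hom y (t : R) : even_part (t *: y) = `|t| * even_part y.
Proof.
have [t0|t0|->] := ltgtP t 0.
- have nt : 0 < - t by rewrite oppr_gt0.
  rewrite ltr0_norm// -{1}[t]opprK scaleNr even_partN /even_part -scalerN !(N_hom _ nt).
  by field.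
- by rewrite gtr0_norm// /even_part -scalerN !(N_hom _ t0); field.
- by rewrite scale0r /even_part oppr0 N0 normr0 mul0r addr0 mul0r.
Qed.

(** By evenness of the Hessian, N(y) and N(-y) have the same second derivative along the line: it
    survives in the half sum and cancels in the half difference. *)
Lemma parts_line u v : indep u v ->
  exists a1 b1 : R -> R,
  [/\ forall t : R, is_derive t 1 (fun s => even_part (u + s *: v)) (a1 t),
      forall t : R, is_derive t 1 a1 (h v (u + t *: v)),
      forall t : R, is_derive t 1 (fun s => odd_part (u + s *: v)) (b1 t) &
      forall t : R, is_derive t 1 b1 0].
Proof.
move=> uv; have [f1 [_ [_ [_ [d0 d1 _ _ _]]]]] := N_line uv.
have [g1 [_ [_ [_ [e0 e1 _ _ _]]]]] := N_line (indepNN uv).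
have e0' t : is_derive t (1 : R) (fun s => N (- (u + s *: v))) (g1 t).
  have -> : (fun s => N (- (u + s *: v))) = (fun s => N (- u + s *: (- v))).
    by apply/funext => s; rewrite opprD scalerN.
  exact: e0.
have e1' t : is_derive t (1 : R) g1 (h v (u + t *: v)).
  apply: (is_derive_eq (e1 t)); rewrite scalerN -opprD.
  have vy : indep v (u + t *: v) by apply/indepC/indep_line.
  rewrite h_opp ?hess_even//; apply/eqP => /eqP; rewrite oppr_eq0 => /eqP y0.
  by have := vy 0 1; rewrite y0 scaler0 addr0 scale0r => /(_ erefl)[_ /eqP]; rewrite oner_eq0.
exists (fun t => 2^-1 * (f1 t + g1 t)), (fun t => 2^-1 * (f1 t + -1 * g1 t)); split => t.
- have -> : (fun s => even_part (u + s *: v)) =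
    (fun s => 2^-1 * (N (u + s *: v) + N (- (u + s *: v)))).
    by apply/funext => s; rewrite /even_part mulrC.
  exact: (is_derive1_mulc 2^-1 (is_derive1_add (d0 t) (e0' t))).
- apply: (is_derive_eq (is_derive1_mulc 2^-1 (is_derive1_add (d1 t) (e1' t)))).
  by move: (h _ _) => z; rewrite -[z + z]/(z + z : R); field.
- have -> : (fun s => odd_part (u + s *: v)) =
    (fun s => 2^-1 * (N (u + s *: v) + -1 * N (- (u + s *: v)))).
    by apply/funext => s; rewrite /odd_part mulN1r mulrC.
  exact: (is_derive1_mulc 2^-1 (is_derive1_add (d0 t) (is_derive1_mulc (-1) (e0' t)))).
- apply: (is_derive_eq (is_derive1_mulc 2^-1 (is_derive1_add (d1 t) (is_derive1_mulc (-1) (e1' t))))).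
  by rewrite mulN1r subrr mulr0.
Qed.

Let odd_part_affine u v : indep u v ->
  exists A B, forall t, odd_part (u + t *: v) = A + B * t.
Proof.
move=> uv; have [_ [b1 [_ _ d0 d1]]] := parts_line uv.
have E1 t : b1 t = b1 0 by exact: is_derive_0_is_cst.
by exists (odd_part (u + 0 *: v)), (b1 0) => t; exact: (derive1_const d0 E1).
Qed.

(** The odd part is A + B t on u + R v and A' + B' s on v + R u. Computing it on both lines at u + v
    and, by homogeneity, at u + 2 v gives B = A': the slope along v is the value at v. *)
Lemma odd_partD_indep u v : indep u v -> odd_part (u + v) = odd_part u + odd_part v.
Proof.
move=> uv; have [A [B H]] := odd_part_affine uv.
have [A' [B' H']] := odd_part_affine (indepC uv).
have h1 := H 0; rewrite scale0r mulr0 !addr0 in h1.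
have h1' := H' 0; rewrite scale0r mulr0 !addr0 in h1'.
have h2 := H 1; rewrite scale1r mulr1 in h2.
have h3 := H 2.
have Euv : u + 2 *: v = 2 *: (v + 2^-1 *: u).
  by rewrite scalerDr scalerA divff// scale1r addrC.
rewrite Euv odd_part_hom H' in h3.
have h4 := H' 1; rewrite scale1r addrC h2 mulr1 in h4.
by rewrite h1 h1' h2; lra.
Qed.

(** The premises are |s| (A + B / s) = A' + B' s at s = 1, 2, -1, -2. Positive s give A = B' and B =
    A'; negative s give the same relations with the opposite sign. *)
Let lin4 (A B A' B' : R) :
  1 * (A + B * 1) = A' + B' * 1 -> 2 * (A + B / 2) = A' + B' * 2 ->
  1 * (A + B * -1) = A' + B' * -1 -> 2 * (A + B * - 2^-1) = A' + B' * -2 ->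
  A = 0 /\ B = 0 /\ A' = 0 /\ B' = 0.
Proof. by move=> *; split; [lra|split; [lra|split; lra]]. Qed.

(** On both lines the even part is sqrt q / D plus an affine remainder, with the same D because
    reversing q preserves it. Absolute homogeneity relates the two remainders by a factor |s|, which
    kills them. *)
Lemma even_part_sqrt u v : indep u v -> exists q0 q1 q2 D : R,
  [/\ 0 < D, forall t, 0 <= q0 + q1 * t + q2 * t ^+ 2, 0 <= q2,
      forall t, even_part (u + t *: v) = Num.sqrt (q0 + q1 * t + q2 * t ^+ 2) / D &
      even_part v = Num.sqrt q2 / D].
Proof.
move=> uv; have vu := indepC uv.
have [q0 [q1 [q2 [q2_gt0 Q P]]]] := hess_poly2 uv.
have h0 t : 0 < h v (u + t *: v) by apply/h_gt0/indepC/indep_line.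
have h0' t : 0 < h u (v + t *: u) by apply/h_gt0/indepC/indep_line.
have q0_gt0 : 0 < q0.
  by have := Q 0; rewrite mulr0 expr0n mulr0 !addr0 => <-; rewrite powR_gt0.
have [a1 [_ [d0 d1 _ _]]] := parts_line uv.
have [a1' [_ [d0' d1' _ _]]] := parts_line vu.
have [D0 [A [B H]]] := derive2_poly2_powR d0 d1 h0 Q q2_gt0.
have [_ [A' [B' H']]] := derive2_poly2_powR d0' d1' h0' P q0_gt0.
rewrite [q2 * q0]mulrC in H'.
set D := q0 * q2 - q1 ^+ 2 / 4 in D0 H H'.
have key (s : R) : s != 0 -> `|s| * (A + B * s^-1) = A' + B' * s.
  move=> s0.
  have Euv : v + s *: u = s *: (u + s^-1 *: v).
    by rewrite scalerDr scalerA mulfV// scale1r addrC.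
  have := H' s; rewrite Euv even_part_hom H.
  have -> : q2 + q1 * s + q0 * s ^+ 2 = s ^+ 2 * (q0 + q1 * s^-1 + q2 * s^-1 ^+ 2) by field.
  rewrite sqrtrM ?sqr_ge0// sqrtr_sqr.
  by move: (Num.sqrt _) => S; move: `|s| s^-1 D^-1 => a b c ?; lra.
have k1 := key 1 (oner_neq0 _); have k2 := key 2 _; have k3 := key (-1) _.
have k4 := key (-2) _; move: k2 k3 k4.
rewrite !oppr_eq0 oner_neq0 pnatr_eq0/= => /(_ isT) k2 /(_ isT) k3 /(_ isT) k4.
rewrite normr1 invr1 in k1.
rewrite ger0_norm// in k2.
rewrite normrN normr1 invrN invr1 in k3.
rewrite normrN ger0_norm// invrN in k4.
have [A0 [B0 [A'0 B'0]]] : A = 0 /\ B = 0 /\ A' = 0 /\ B' = 0.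
  exact: lin4.
exists q0, q1, q2, D; split => //.
- by move=> t; rewrite -Q powR_ge0.
- exact: ltW.
- by move=> t; rewrite H A0 B0 mul0r !addr0.
- by have := H' 0; rewrite scale0r expr0n/= !mulr0 !addr0 A'0 !addr0.
Qed.

Lemma sqr_even_part_line_indep u v (t : R) : indep u v ->
  even_part (u + t *: v) ^+ 2 = even_part u ^+ 2
   + t * (even_part (u + v) ^+ 2 - even_part u ^+ 2 - even_part v ^+ 2)
   + t ^+ 2 * even_part v ^+ 2.
Proof.
move=> /even_part_sqrt[q0 [q1 [q2 [D [D0 Q0 q20 H Hv]]]]].
have Dn0 : D != 0 by rewrite gt_eqF.
have S s : even_part (u + s *: v) ^+ 2 = (q0 + q1 * s + q2 * s ^+ 2) / D ^+ 2.
  by rewrite H expr_div_n sqr_sqrtr.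
have S0 := S 0; have S1 := S 1; rewrite scale0r addr0 in S0; rewrite scale1r in S1.
rewrite S S0 S1 Hv expr_div_n sqr_sqrtr//.
by field.
Qed.

Lemma not_indep u v : ~ indep u v -> exists c : R, v = c *: u \/ u = c *: v.
Proof.
move=> /existsNP[a /existsNP[b /not_implyP[H /not_andP ab]]].
have [a0|a0] := eqVneq a 0; last first.
  exists (- b / a); right; apply: (scalerI a0); rewrite scalerA mulrC divfK//.
  by rewrite scaleNr; apply/eqP; rewrite -addr_eq0; apply/eqP.
have b0 : b != 0 by case: ab => // /eqP.
exists 0; left; rewrite scale0r; apply: (scalerI b0).
by move: H; rewrite a0 scale0r add0r scaler0.
Qed.

Lemma odd_partD u v : odd_part (u + v) = odd_part u + odd_part v.
Proof.
have [/odd_partD_indep//|/not_indep[c [->|->]]] := pselect (indep u v).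
  by rewrite -{1}[u]scale1r -scalerDl !odd_part_hom; ring.
by rewrite -{2}[v]scale1r -scalerDl !odd_part_hom; ring.
Qed.

Lemma sqr_even_part_line u v (t : R) :
  even_part (u + t *: v) ^+ 2 = even_part u ^+ 2
   + t * (even_part (u + v) ^+ 2 - even_part u ^+ 2 - even_part v ^+ 2)
   + t ^+ 2 * even_part v ^+ 2.
Proof.
have [|/not_indep[c [->|->]]] := pselect (indep u v); first exact: sqr_even_part_line_indep.
  rewrite scalerA -{1 4}[u]scale1r -!scalerDl !even_part_hom !exprMn !real_normK ?num_real; ring.
rewrite -{5}[v]scale1r -!scalerDl !even_part_hom !exprMn !real_normK ?num_real; ring.
Qed.

End MinkowskiNorm.

(** * Derivatives along the fibres *)

Section FiberCoordinates.
Context {R : realType} {n : nat}.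
Notation W := ('rV[R]_n * 'rV[R]_n)%type.

Lemma is_derive_fiber_coord (z d : W) (i : 'I_n) :
  is_derive z d (fun p : W => p.2 0 i) (d.2 0 i).
Proof.
have H : (fun h : R => h^-1 *: (((h *: d + z).2 0 i : R) - z.2 0 i)) @ 0^' --> (d.2 0 i : R).
  apply: cvg_near_cst; near=> h.
  have h0 : h != 0 by near: h; exact: nbhs_dnbhs_neq.
  by rewrite /= !mxE addrK /GRing.scale/= mulKf.
apply: DeriveDef; first by apply/cvg_ex; exists (d.2 0 i).
exact: cvg_lim H.
Unshelve. all: by end_near. Qed.

Lemma smooth_on_fiber_coord (A : set W) (i : 'I_n) : smooth_on A (fun p : W => p.2 0 i).
Proof.
have c : continuous (fun p : W => p.2 0 i).
  move=> p; apply: (@continuous_comp _ _ _ (snd : W -> 'rV[R]_n) (fun y : 'rV[R]_n => y 0 i)).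
    exact: cvg_snd.
  exact: coord_continuous.
apply/smooth_onP => -[|k]; split => //; try by move=> x _; exact: c.
split => [x v _|v]; first exact: (@ex_derive _ _ _ _ _ _ _ (is_derive_fiber_coord x v i)).
have -> : 'D_v (fun p : W => p.2 0 i) = (fun=> v.2 0 i).
  by apply/funext => x; rewrite (@derive_val _ _ _ _ _ _ _ (is_derive_fiber_coord x v i)).
exact: Ck_cst.
Qed.

Lemma open_nonzero (A : set W) (g : W -> R) : open A -> smooth_on A g ->
  open [set z | A z /\ g z != 0].
Proof.
move=> oA gA; rewrite openE => z [Az gz]; rewrite /interior.
have N : \forall y \near z, g y != 0.
  have : g @ z --> g z := smooth_on_continuous gA Az.
  by move=> /cvgr_neq0; apply.
by apply: filterI N; exact: open_nbhs_nbhs.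
Qed.

End FiberCoordinates.

(* Locked: comparing two directional derivatives up to conversion is very costly. *)
HB.lock Definition fiber_diff (R : realType) (n : nat) (v : 'rV[R]_n)
    (f : 'rV[R]_n * 'rV[R]_n -> R) : 'rV[R]_n * 'rV[R]_n -> R :=
  'D_((0, v) : 'rV[R]_n * 'rV[R]_n) f.

Notation "''d_' v" := (fiber_diff v) (at level 8, v at level 2, format "''d_' v").

Section FiberDerivatives.
Context {R : realType} {n : nat}.
Notation W := ('rV[R]_n * 'rV[R]_n)%type.
Implicit Types (f g : W -> R) (z : W) (u v w : 'rV[R]_n).

Lemma fiber_diffE v f : 'd_v f = 'D_((0, v) : W) f.
Proof. by rewrite unlock. Qed.

Lemma dyE k f : dy k f = 'd_('e_k) f.
Proof. by rewrite fiber_diffE. Qed.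

Variables (A : set W).
Hypothesis oA : open A.

Lemma smooth_fiber_diff v f : smooth_on A f -> smooth_on A ('d_v f).
Proof. by rewrite fiber_diffE => fA; exact: (smooth_onD (0, v) fA). Qed.

Lemma eq_fiber_diff v f g z : A z -> (forall y, A y -> f y = g y) -> 'd_v f z = 'd_v g z.
Proof. by rewrite !fiber_diffE => Az fg; exact: (eq_derive_on (0, v) oA Az fg). Qed.

Lemma fiber_diff_add v f g z : A z -> smooth_on A f -> smooth_on A g ->
  'd_v (fun p => f p + g p) z = 'd_v f z + 'd_v g z.
Proof. by rewrite !fiber_diffE => Az fA gA; exact: (derive_add Az _ fA gA). Qed.

Lemma fiber_diff_sub v f g z : A z -> smooth_on A f -> smooth_on A g ->
  'd_v (fun p => f p - g p) z = 'd_v f z - 'd_v g z.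
Proof. by rewrite !fiber_diffE => Az fA gA; exact: (derive_sub Az _ fA gA). Qed.

Lemma fiber_diff_mul v f g z : A z -> smooth_on A f -> smooth_on A g ->
  'd_v (fun p => f p * g p) z = 'd_v f z * g z + f z * 'd_v g z.
Proof. by rewrite !fiber_diffE => Az fA gA; exact: (derive_mul Az _ fA gA). Qed.

Lemma fiber_diff_mulc v f (c : R) z : A z -> smooth_on A f ->
  'd_v (fun p => c * f p) z = c * 'd_v f z.
Proof. by rewrite !fiber_diffE => Az fA; exact: (derive_mulc Az c _ fA). Qed.

Lemma fiber_diff_mulrc v f (c : R) z : A z -> smooth_on A f ->
  'd_v (fun p => f p * c) z = 'd_v f z * c.
Proof.
rewrite !fiber_diffE => Az fA.
by rewrite (derive_mul Az _ fA (smooth_on_cst c)) derive_cst mulr0 addr0.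
Qed.

Lemma fiber_diff_bigsum (I : Type) (s : seq I) (f : I -> W -> R) v z : A z ->
  (forall i, smooth_on A (f i)) ->
  'd_v (fun p => \sum_(i <- s) f i p) z = \sum_(i <- s) 'd_v (f i) z.
Proof.
move=> Az fA; rewrite fiber_diffE (derive_bigsum oA Az _ _ _ fA).
by apply: eq_bigr => i _; rewrite fiber_diffE.
Qed.

Lemma fiber_diff_coord v i z : 'd_v (fun p : W => p.2 0 i) z = v 0 i.
Proof.
rewrite fiber_diffE.
exact: (@derive_val _ _ _ _ _ _ _ (is_derive_fiber_coord z (0, v) i)).
Qed.

Lemma fiber_diffC u v f z : A z -> smooth_on A f -> 'd_u ('d_v f) z = 'd_v ('d_u f) z.
Proof. by rewrite !fiber_diffE => Az fA; exact: (deriveC (0, u) (0, v) oA Az fA). Qed.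

Lemma fiber_diff_sum v f z : A z -> smooth_on A f ->
  'd_v f z = \sum_k v 0 k * 'd_('e_k) f z.
Proof.
move=> Az fA; rewrite fiber_diffE.
have -> : ((0, v) : W) = \sum_k v 0 k *: ((0, 'e_k) : W).
  rewrite [LHS]surjective_pairing [RHS]surjective_pairing.
  rewrite (raddf_sum (fst : W -> _)) (raddf_sum (snd : W -> _)) /=; congr (_, _).
    by rewrite big1// => k _; rewrite scaler0.
  exact: row_sum_delta.
rewrite (derive_dir_sum _ _ oA Az fA); apply: eq_bigr => k _.
have D := derive_dirZ (v 0 k) (smooth_on_derivable (v := (0, 'e_k)) fA Az).
by rewrite (@derive_val _ _ _ _ _ _ _ D) fiber_diffE.
Qed.

Lemma fiber_diffZ (a : R) v f z : A z -> smooth_on A f -> 'd_(a *: v) f z = a * 'd_v f z.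
Proof.
move=> Az fA; rewrite (fiber_diff_sum _ Az fA) (fiber_diff_sum v Az fA) mulr_sumr.
by apply: eq_bigr => k _; rewrite mxE mulrA.
Qed.

Lemma fiber_diffD u v f z : A z -> smooth_on A f ->
  'd_(u + v) f z = 'd_u f z + 'd_v f z.
Proof.
move=> Az fA; rewrite (fiber_diff_sum _ Az fA) (fiber_diff_sum v Az fA) (fiber_diff_sum u Az fA).
by rewrite -big_split/=; apply: eq_bigr => k _; rewrite mxE mulrDl.
Qed.

Lemma fiber_diff3_sum u v w f z : A z -> smooth_on A f ->
  'd_u ('d_v ('d_w f)) z =
  \sum_j u 0 j * \sum_k v 0 k * \sum_l w 0 l * 'd_('e_j) ('d_('e_k) ('d_('e_l) f)) z.
Proof.
move=> Az fA.
have sc g (c : R) (gA : smooth_on A g) : smooth_on A (fun p => c * g p).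
  exact: (smooth_on_mul oA (smooth_on_cst c) gA).
have s1 l : smooth_on A ('d_('e_l) f) by exact: smooth_fiber_diff.
have s2 k l : smooth_on A ('d_('e_k) ('d_('e_l) f)) by exact: (smooth_fiber_diff 'e_k (s1 l)).
have s2w k : smooth_on A ('d_('e_k) ('d_w f)).
  exact: (smooth_fiber_diff 'e_k (smooth_fiber_diff w fA)).
rewrite (fiber_diff_sum u Az (smooth_fiber_diff v (smooth_fiber_diff w fA))).
apply: eq_bigr => j _; congr (_ * _).
have E2 y : A y -> 'd_v ('d_w f) y = \sum_k v 0 k * 'd_('e_k) ('d_w f) y.
  by move=> Ay; exact: (fiber_diff_sum v Ay (smooth_fiber_diff w fA)).
rewrite (eq_fiber_diff 'e_j Az E2) (fiber_diff_bigsum _ 'e_j Az (fun k => sc _ _ (s2w k))).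
apply: eq_bigr => k _; rewrite (fiber_diff_mulc 'e_j _ Az (s2w k)); congr (_ * _).
have E1 y : A y -> 'd_('e_k) ('d_w f) y = \sum_l w 0 l * 'd_('e_k) ('d_('e_l) f) y.
  move=> Ay; have E0 x : A x -> 'd_w f x = \sum_l w 0 l * 'd_('e_l) f x.
    by move=> Ax; exact: (fiber_diff_sum w Ax fA).
  rewrite (eq_fiber_diff 'e_k Ay E0) (fiber_diff_bigsum _ 'e_k Ay (fun l => sc _ _ (s1 l))).
  by apply: eq_bigr => l _; rewrite (fiber_diff_mulc 'e_k _ Ay (s1 l)).
rewrite (eq_fiber_diff 'e_j Az E1) (fiber_diff_bigsum _ 'e_j Az (fun l => sc _ _ (s2 k l))).
by apply: eq_bigr => l _; rewrite (fiber_diff_mulc 'e_j _ Az (s2 k l)).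
Qed.

(** A fibre coordinate is linear in y, so at most one of the three derivatives falls on it. *)
Lemma fiber_diff3_mul_coord u v w f z i : A z -> smooth_on A f ->
  'd_u ('d_v ('d_w (fun p => f p * p.2 0 i))) z =
  'd_u ('d_v ('d_w f)) z * z.2 0 i + 'd_v ('d_w f) z * u 0 i
  + 'd_u ('d_w f) z * v 0 i + 'd_u ('d_v f) z * w 0 i.
Proof.
move=> Az fA.
have yA : smooth_on A (fun p : W => p.2 0 i) := @smooth_on_fiber_coord _ _ A i.
have M g t q (gA : smooth_on A g) : A q ->
    'd_t (fun p : W => g p * p.2 0 i) q = 'd_t g q * q.2 0 i + g q * t 0 i.
  by move=> Aq; rewrite (fiber_diff_mul t Aq gA yA) fiber_diff_coord.
have sc g (c : R) (gA : smooth_on A g) : smooth_on A (fun p => g p * c).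
  exact: (smooth_on_mul oA gA (smooth_on_cst c)).
have sy g (gA : smooth_on A g) : smooth_on A (fun p => g p * p.2 0 i).
  exact: (smooth_on_mul oA gA yA).
have fw := smooth_fiber_diff w fA; have fv := smooth_fiber_diff v fA.
have fvw := smooth_fiber_diff v fw.
have E1 q : A q -> 'd_w (fun p => f p * p.2 0 i) q = 'd_w f q * q.2 0 i + f q * w 0 i.
  by move=> Aq; exact: M.
have E2 q : A q -> 'd_v ('d_w (fun p => f p * p.2 0 i)) q =
    ('d_v ('d_w f) q * q.2 0 i + 'd_w f q * v 0 i) + 'd_v f q * w 0 i.
  move=> Aq; rewrite (eq_fiber_diff v Aq E1) (fiber_diff_add v Aq (sy _ fw) (sc _ _ fA)).
  by rewrite (M _ _ _ fw Aq) (fiber_diff_mulrc v _ Aq fA).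
rewrite (eq_fiber_diff u Az E2).
rewrite (fiber_diff_add u Az (smooth_on_add oA (sy _ fvw) (sc _ _ fw)) (sc _ _ fv)).
rewrite (fiber_diff_add u Az (sy _ fvw) (sc _ _ fw)).
by rewrite (M _ _ _ fvw Az) (fiber_diff_mulrc u _ Az fw) (fiber_diff_mulrc u _ Az fv).
Qed.

Lemma near_fiber_line z v : A z -> \forall h \near (0 : R), A (z + h *: ((0, v) : W)).
Proof.
move=> Az.
have c : (fun h : R => z + h *: ((0, v) : W)) @ (0 : R) --> z + (0 : R) *: ((0, v) : W).
  by apply: cvgD; [exact: cvg_cst|apply: cvgZr_tmp; exact: cvg_id].
rewrite scale0r addr0 in c.
by apply: c; exact: open_nbhs_nbhs.
Qed.

End FiberDerivatives.

Lemma fiber_line (R : realType) (n : nat) (z : 'rV[R]_n * 'rV[R]_n) v (h : R) :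
  z + h *: ((0, v) : 'rV[R]_n * 'rV[R]_n) = (z.1, z.2 + h *: v).
Proof.
by case: z => x y; rewrite /GRing.scale/= -[LHS]/(x + h *: 0, y + h *: v) scaler0 addr0.
Qed.

Lemma is_derive_fiber_line (R : realType) (n : nat) (A : set ('rV[R]_n * 'rV[R]_n)) f
    (x u v : 'rV[R]_n) (t : R) : A (x, u + t *: v) -> smooth_on A f ->
  is_derive t 1 (fun s : R => f (x, u + s *: v)) ('d_v f (x, u + t *: v)).
Proof.
move=> Az fA.
have E : (fun s : R => f (x, u + s *: v)) =
    (fun s : R => f ((x, u) + s *: ((0, v) : 'rV[R]_n * 'rV[R]_n))).
  by apply/funext => s; rewrite fiber_line.
rewrite E fiber_diffE -[(x, u + t *: v)]/((x, u).1, (x, u).2 + t *: v) -fiber_line.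
by apply: is_derive_line; rewrite fiber_line; exact: (smooth_on_derivable fA Az).
Qed.

(** * Finsler metrics in a chart *)

Section FinslerChart.
Context {R : realType} {n : nat}.
Notation W := ('rV[R]_n * 'rV[R]_n)%type.
Implicit Types (f g : W -> R) (z : W) (u v w : 'rV[R]_n).
Variables (O : set 'rV[R]_n) (F : W -> R).
Hypothesis oO : open O.
Let A : set W := [set z | O z.1 /\ z.2 != 0].
Hypothesis F_ge0 : forall z, O z.1 -> 0 <= F z.
Hypothesis F_smooth : smooth_on A F.
Hypothesis F_hom : forall z (t : R), O z.1 -> 0 < t -> F (z.1, t *: z.2) = t * F z.
Hypothesis F_posdef : forall z, A z -> posdef (fund_tensor F z).

Lemma open_slit : open A.
Proof.
have -> : A = (fst @^-1` O) `&` (snd @^-1` (~` [set (0 : 'rV[R]_n)])).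
  by apply/seteqP; split=> z [Oz z0]; split => //; [move=> /= /eqP; rewrite (negbTE z0)|apply/eqP].
apply: openI; apply: open_comp => //; try by move=> z _; [exact: cvg_fst|exact: cvg_snd].
- by move=> z _; exact: cvg_fst.
- by move=> z _; exact: cvg_snd.
by apply: closed_openC; apply: accessible_closed_set1; apply: hausdorff_accessible; exact: norm_hausdorff.
Qed.
Let oA := open_slit.

Notation H u v z := ('d_u ('d_v F) z).

Let sF v : smooth_on A ('d_v F) := smooth_fiber_diff v F_smooth.
Let sH u v : smooth_on A ('d_u ('d_v F)) := smooth_fiber_diff u (sF v).

Lemma euler z : A z -> 'd_(z.2) F z = F z.
Proof.
move=> Az; have [Oz z0] := Az.
have [fd fe] : is_derive (0 : R) (1 : R) (fun h : R => F (z.1, z.2 + h *: z.2)) ('d_(z.2) F z).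
  have -> : 'd_(z.2) F z = 'd_(z.2) F (z.1, z.2 + (0 : R) *: z.2).
    by rewrite scale0r addr0; case: (z).
  by apply: is_derive_fiber_line F_smooth; rewrite scale0r addr0.
have N : \forall h \near (0 : R), (1 + h) * F z = F (z.1, z.2 + h *: z.2).
  near=> h; rewrite -{1}[z.2]scale1r -scalerDl F_hom//.
  rewrite -ltrBlDl sub0r; near: h; apply: lt_nbhsr; rewrite oppr_lt0; exact: ltr01.
have D : is_derive (0 : R) (1 : R) (fun h : R => (1 + h) * F z) (F z).
  apply: (is_derive_eq (is_derive1_mul (is_derive1_add (is_derive_cst (1 : R) (0 : R) (1 : R))
    (is_derive_id (0 : R) (1 : R))) (is_derive_cst (F z) (0 : R) (1 : R)))).
  by rewrite add0r mul1r mulr0 addr0.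
have [_] := near_eq_is_derive N D.
by rewrite fe => ->.
Unshelve. all: by end_near. Qed.

Lemma fiber_hessC u v z : A z -> H u v z = H v u z.
Proof. by move=> Az; exact: (fiber_diffC oA u v Az F_smooth). Qed.

Lemma fiber_hessDl u u' v z : A z -> H (u + u') v z = H u v z + H u' v z.
Proof. by move=> Az; exact: (fiber_diffD oA u u' Az (sF v)). Qed.

Lemma fiber_hessZl (a : R) u v z : A z -> H (a *: u) v z = a * H u v z.
Proof. by move=> Az; exact: (fiber_diffZ oA a u Az (sF v)). Qed.

Lemma fiber_hessDr u v v' z : A z -> H u (v + v') z = H u v z + H u v' z.
Proof.
move=> Az; rewrite (fiber_hessC u (v + v') Az) (fiber_hessDl v v' u Az).
by rewrite (fiber_hessC v u Az) (fiber_hessC v' u Az).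
Qed.

Lemma fiber_hessZr (a : R) u v z : A z -> H u (a *: v) z = a * H u v z.
Proof.
by move=> Az; rewrite (fiber_hessC u (a *: v) Az) (fiber_hessZl a v u Az) (fiber_hessC v u Az).
Qed.

(** Differentiate Euler's identity F = y^k F_k in the direction [v]: the term v^k F_k cancels the
    left side. *)
Lemma fiber_hess_radial v z : A z -> H (z.2) v z = 0.
Proof.
move=> Az.
have sy k : smooth_on A (fun p : W => p.2 0 k) := @smooth_on_fiber_coord _ _ A k.
have E p : A p -> F p = \sum_k p.2 0 k * 'd_('e_k) F p.
  by move=> Ap; rewrite -{1}(euler Ap) (fiber_diff_sum oA p.2 Ap F_smooth).
have := eq_fiber_diff oA v Az E.
have s1 k : smooth_on A (fun p => p.2 0 k * 'd_('e_k) F p).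
  exact: (smooth_on_mul oA (sy k) (sF 'e_k)).
rewrite (fiber_diff_bigsum oA _ v Az s1).
have D k : 'd_v (fun p : W => p.2 0 k * 'd_('e_k) F p) z =
    v 0 k * 'd_('e_k) F z + z.2 0 k * H 'e_k v z.
  rewrite (fiber_diff_mul v Az (sy k) (sF 'e_k)) fiber_diff_coord.
  by rewrite (fiber_hessC v 'e_k Az).
under eq_bigr do rewrite D.
rewrite big_split/= -(fiber_diff_sum oA v Az F_smooth) -(fiber_diff_sum oA z.2 Az (sF v)).
by move=> /eqP; rewrite -subr_eq0 opprD addrA subrr sub0r oppr_eq0 => /eqP.
Qed.

Lemma fund_tensorE z i j : A z ->
  fund_tensor F z i j = F z * H 'e_i 'e_j z + 'd_('e_i) F z * 'd_('e_j) F z.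
Proof.
move=> Az; rewrite mxE !dyE.
have E p : A p -> 'd_('e_j) (fun p => F p ^+ 2) p = 2 * (F p * 'd_('e_j) F p).
  move=> Ap; have -> : (fun p => F p ^+ 2) = (fun p => F p * F p) by apply/funext => p0; rewrite expr2.
  by rewrite (fiber_diff_mul 'e_j Ap F_smooth F_smooth); ring.
have s1 := smooth_on_mul oA F_smooth (sF 'e_j).
rewrite (eq_fiber_diff oA 'e_i Az E) (fiber_diff_mulc 'e_i 2 Az s1).
by rewrite (fiber_diff_mul 'e_i Az F_smooth (sF 'e_j)); field.
Qed.

Lemma y_lowE z i : A z -> y_low F i z = F z * 'd_('e_i) F z.
Proof.
move=> Az; rewrite /y_low.
transitivity (F z * \sum_j z.2 0 j * H 'e_j 'e_i z
   + 'd_('e_i) F z * \sum_j z.2 0 j * 'd_('e_j) F z).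
  rewrite !mulr_sumr -big_split/=; apply: eq_bigr => j _.
  by rewrite fund_tensorE// (fiber_hessC 'e_i 'e_j Az); ring.
rewrite -(fiber_diff_sum oA z.2 Az (sF 'e_i)) (fiber_hess_radial 'e_i Az).
by rewrite -(fiber_diff_sum oA z.2 Az F_smooth) (euler Az) mulr0 add0r mulrC.
Qed.

Lemma fund_tensor_form z v : A z ->
  \sum_i \sum_j fund_tensor F z i j * v 0 i * v 0 j = F z * H v v z + 'd_v F z ^+ 2.
Proof.
move=> Az.
transitivity (F z * (\sum_i v 0 i * H 'e_i v z) + (\sum_i v 0 i * 'd_('e_i) F z) * 'd_v F z).
  rewrite mulr_sumr mulr_suml -big_split/=; apply: eq_bigr => i _.
  rewrite (fiber_hessC 'e_i v Az) (fiber_diff_sum oA v Az (sF 'e_i)).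
  rewrite [in X in _ + X](fiber_diff_sum oA v Az F_smooth).
  rewrite !mulr_sumr -big_split/=; apply: eq_bigr => j _.
  by rewrite fund_tensorE// (fiber_hessC 'e_i 'e_j Az); ring.
by rewrite -(fiber_diff_sum oA v Az (sF v)) -(fiber_diff_sum oA v Az F_smooth) expr2.
Qed.

Lemma F_gt0 z : A z -> 0 < F z.
Proof.
move=> Az; have [Oz z0] := Az.
have := F_posdef Az z0; rewrite (fund_tensor_form z.2 Az) (fiber_hess_radial z.2 Az).
rewrite mulr0 add0r (euler Az) => F2.
by rewrite lt_neqAle F_ge0// andbT eq_sym; apply: contraTneq F2 => ->; rewrite expr0n ltxx.
Qed.

Lemma angularE z i j : A z -> angular F i j z = F z * H 'e_i 'e_j z.
Proof.
move=> Az; rewrite /angular (fund_tensorE i j Az) !y_lowE//.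
by field; rewrite gt_eqF// F_gt0.
Qed.

Lemma angular_mixedE z i j : A z ->
  angular_mixed F i j z = (i == j)%:R - (F z)^-1 * z.2 0 i * 'd_('e_j) F z.
Proof.
move=> Az; rewrite /angular_mixed y_lowE//.
by field; rewrite gt_eqF// F_gt0.
Qed.

(** On a vector annihilated by dF the form g is F times the Hessian. Subtracting the multiple F_v /
    F of the radial vector achieves this without changing the Hessian, and the result is nonzero as
    [v] is not radial. *)
Lemma fiber_hess_gt0 z v : A z -> (forall c : R, v <> c *: z.2) -> 0 < H v v z.
Proof.
move=> Az vz; have Fz := F_gt0 Az.
pose c := 'd_v F z / F z; pose v' := v + (- c) *: z.2.
have v'0 : v' != 0.
  by apply/eqP => /eqP; rewrite /v' scaleNr subr_eq0 => /eqP; exact: vz.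
have D0 : 'd_(v') F z = 0.
  rewrite (fiber_diffD oA v _ Az F_smooth) (fiber_diffZ oA _ _ Az F_smooth) (euler Az).
  by rewrite /c mulNr divfK ?subrr// gt_eqF.
have HE : H v' v' z = H v v z.
  rewrite (fiber_hessDl v _ _ Az) !(fiber_hessDr _ v _ Az) !(fiber_hessZl _ z.2 _ Az).
  rewrite (fiber_hessZr _ _ z.2 Az) (fiber_hessC v z.2 Az) !(fiber_hess_radial _ Az).
  by rewrite !mulr0 !addr0.
have := F_posdef Az v'0; rewrite (fund_tensor_form v' Az) D0 expr0n addr0 HE.
by rewrite pmulr_rgt0.
Qed.

(** The vector a u + b v is in the kernel of the Hessian at itself, so a u and - b v agree modulo
    that kernel. *)
Lemma fiber_hess_swap x u v (a b : R) : A (x, a *: u + b *: v) ->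
  a ^+ 2 * H u u (x, a *: u + b *: v) = b ^+ 2 * H v v (x, a *: u + b *: v).
Proof.
set z := (x, _) => Az.
have hu := fiber_hess_radial u Az; have hv := fiber_hess_radial v Az.
rewrite /z/= -/z in hu hv.
rewrite (fiber_hessDl _ _ u Az) !(fiber_hessZl _ _ u Az) in hu.
rewrite (fiber_hessDl _ _ v Az) !(fiber_hessZl _ _ v Az) (fiber_hessC u v Az) in hv.
move: (H u u z) (H v u z) (H v v z) hu hv => p q r hu hv.
transitivity (a * (a * p + b * q) - b * (a * q + b * r) + b ^+ 2 * r); first by ring.
by rewrite hu hv; ring.
Qed.

Lemma fiber_diff_hom g v z (s c : R) : A z -> 0 < s -> smooth_on A g ->
  (forall p, A p -> g (p.1, s *: p.2) = c * g p) ->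
  'd_v g (z.1, s *: z.2) = s^-1 * (c * 'd_v g z).
Proof.
move=> Az s0 gA gs; have [Oz z0] := Az.
have Asz : A (z.1, s *: z.2) by split => //=; rewrite scaler_eq0 negb_or z0 gt_eqF.
have D1 : is_derive (0 : R) (1 : R) (fun h : R => g (z.1, s *: z.2 + h *: (s *: v)))
    (s * 'd_v g (z.1, s *: z.2)).
  have := @is_derive_fiber_line _ _ A g z.1 (s *: z.2) (s *: v) 0.
  rewrite scale0r addr0 => /(_ Asz gA) => D.
  by apply: (is_derive_eq D); exact: (fiber_diffZ oA s v Asz gA).
have D2 : is_derive (0 : R) (1 : R) (fun h : R => c * g (z.1, z.2 + h *: v)) (c * 'd_v g z).
  apply: is_derive1_mulc.
  have := @is_derive_fiber_line _ _ A g z.1 z.2 v 0.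
  by rewrite scale0r addr0; case: (z) Az => x y Az; apply.
have N : \forall h \near (0 : R), c * g (z.1, z.2 + h *: v) = g (z.1, s *: z.2 + h *: (s *: v)).
  near=> h; have : A (z + h *: ((0, v) : W)) by near: h; exact: near_fiber_line.
  rewrite fiber_line => /gs <- /=.
  by rewrite scalerDr !scalerA [s * h]mulrC.
have [_ E2] := near_eq_is_derive N D2.
have [_ E1] := D1.
by rewrite -E2 E1 mulKf// gt_eqF.
Unshelve. all: by end_near. Qed.

Lemma fiber_hess_hom v z (s : R) : A z -> 0 < s -> H v v (z.1, s *: z.2) = s^-1 * H v v z.
Proof.
move=> Az s0.
have E p : A p -> 'd_v F (p.1, s *: p.2) = 1 * 'd_v F p.
  move=> Ap; rewrite (fiber_diff_hom (c := s) v Ap s0 F_smooth) ?mulKf ?gt_eqF ?mul1r//.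
  by move=> q [Oq _]; exact: F_hom.
by rewrite (fiber_diff_hom v Az s0 (sF v) E) mul1r.
Qed.

End FinslerChart.

(** * From the Douglas tensor to Halphen's equation *)

Lemma posdef_unitmx (R : realType) (n : nat) (M : 'M[R]_n) : posdef M -> M \in unitmx.
Proof.
move=> Mpd; rewrite -row_free_unit -kermx_eq0; apply/negPn/negP => /rowV0Pn[v /sub_kermxP vM v0].
have := Mpd v v0; rewrite exchange_big/= big1 ?ltxx// => j _.
have := congr1 (fun B : 'rV_n => B 0 j * v 0 j) vM; rewrite !mxE mul0r mulr_suml => E.
by rewrite -[RHS]E; apply: eq_bigr => i _; rewrite [M i j * _]mulrC.
Qed.

(** * Contraction of symmetrised tensors, and a direction outside a given plane *)

Section Sums.
Context {R : realType} {n : nat}.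

Lemma bilinear_sum (w p q c : 'I_n -> R) (x y r : R) :
  \sum_l w l * (x * p l + y * q l + c l * r) =
  x * (\sum_l w l * p l) + y * (\sum_l w l * q l) + (\sum_l w l * c l) * r.
Proof.
by rewrite !mulr_sumr mulr_suml -!big_split/=; apply: eq_bigr => l _; ring.
Qed.

(** Contracts the assumed Berwald curvature with three vectors: for fixed i, [c] gathers all that
    multiplies h_kl, and [b] is h itself. *)
Lemma trilinear_sum (c : 'I_n -> R) (b : 'I_n -> 'I_n -> R) (u v w : 'I_n -> R)
  (C := fun u => \sum_j u j * c j) (B := fun u v => \sum_j u j * \sum_k v k * b j k) :
  \sum_j u j * \sum_k v k * \sum_l w l * (c j * b k l + c k * b j l + c l * b j k) =
  C u * B v w + C v * B u w + C w * B u v.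
Proof.
transitivity (\sum_j u j * (C v * (\sum_l w l * b j l) + C w * (\sum_k v k * b j k) + c j * B v w)).
  apply: eq_bigr => j _; congr (_ * _).
  transitivity (\sum_k v k * (c j * (\sum_l w l * b k l) + C w * b j k + c k * (\sum_l w l * b j l))).
    by apply: eq_bigr => k _; congr (_ * _); rewrite bilinear_sum /C; ring.
  by rewrite bilinear_sum /B /C; ring.
by rewrite bilinear_sum /B /C; ring.
Qed.

(** This is where the dimension enters. Only the coefficient of w is controlled, since y and v may
    be dependent; for a non-radial v it makes the Hessian nondegenerate on the plane of v and w. *)
Lemma exists_not_in_span2 (y v : 'rV[R]_n) : (3 <= n)%N ->
  exists w : 'rV[R]_n, forall a b c : R, a *: y + b *: v + c *: w = 0 -> c = 0.
Proof.
move=> n3; have : ~~ (1%:M <= (y + v)%MS)%MS.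
  rewrite sub1mx /row_full neq_ltn; apply/orP; left.
  apply: leq_trans n3; rewrite ltnS; apply: leq_trans (mxrank_adds_leqif y v) _.
  by rewrite -[2%N]/(1 + 1)%N leq_add// rank_leq_row.
move=> /row_subPn[i wi]; exists (row i 1%:M) => a b c E.
apply/eqP; apply: contraNT wi => c0.
have -> : row i 1%:M = (- (c^-1 * a)) *: y + (- (c^-1 * b)) *: v.
  apply: (scalerI c0); rewrite scalerDr !scalerA !mulrN !mulrA mulfV// !mul1r !scaleNr.
  by apply/eqP; rewrite -opprD -addr_eq0 addrC E.
by apply: addmx_sub; apply: scalemx_sub; [exact: addsmxSl|exact: addsmxSr].
Qed.

End Sums.

(* f is the ratio of the two Hessians; the equations force its derivatives fv and fw to vanish. *)
Lemma proportional_third_derivatives (R : realType)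
  (e b d f fv fw nv nw ev ew bw dw : R) : e != 0 -> e * d - b ^+ 2 != 0 -> f != 0 ->
  fv * e + f * ev = 3 * nv * e -> fw * e + f * ew = 2 * nv * b + nw * e ->
  fv * b + f * ew = 2 * nv * b + nw * e -> fw * b + f * bw = nv * d + 2 * nw * b ->
  fv * d + f * bw = nv * d + 2 * nw * b -> fw * d + f * dw = 3 * nw * d ->
  let k := 3^-1 * (ev * e^-1) in let m := (ew - 2 * (k * b)) * e^-1 in
  [/\ ev = 3 * (k * e), ew = 2 * (k * b) + m * e, bw = k * d + 2 * (m * b) & dw = 3 * (m * d)].
Proof.
move=> e0 D0 f0 E1 E2 E3 E4 E5 E6.
have h1 : fw * e = fv * b by lra.
have h2 : fw * b = fv * d by lra.
have fv0 : fv = 0.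
  apply: (mulfI D0); rewrite mulr0.
  transitivity (e * (fv * d) - b * (fv * b)); first by ring.
  by rewrite -h2 -h1; ring.
have fw0 : fw = 0 by apply: (mulIf e0); rewrite h1 fv0 !mul0r.
rewrite fv0 fw0 !mul0r !add0r in E1 E2 E4 E6.
have ev' : ev = 3 * nv * e / f by apply: (mulfI f0); rewrite E1; field.
have ew' : ew = (2 * nv * b + nw * e) / f by apply: (mulfI f0); rewrite E2; field.
have bw' : bw = (nv * d + 2 * nw * b) / f by apply: (mulfI f0); rewrite E4; field.
have dw' : dw = 3 * nw * d / f by apply: (mulfI f0); rewrite E6; field.
by rewrite /= ev' ew' bw' dw'; split; field; rewrite ?e0 ?f0.
Qed.

Lemma monge_fiber (R : realType) (n : nat) (U : set ('rV[R]_n * 'rV[R]_n)) (v w : 'rV[R]_n)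
    (e b d k m : 'rV[R]_n * 'rV[R]_n -> R) : open U ->
  smooth_on U e -> smooth_on U b -> smooth_on U d -> smooth_on U k -> smooth_on U m ->
  (forall z, U z -> e z != 0) -> (forall z, U z -> e z * d z - b z ^+ 2 != 0) ->
  (forall z, U z -> 'd_v e z = 3 * (k z * e z)) ->
  (forall z, U z -> 'd_w e z = 2 * (k z * b z) + m z * e z) ->
  (forall z, U z -> 'd_v b z = 2 * (k z * b z) + m z * e z) ->
  (forall z, U z -> 'd_w b z = k z * d z + 2 * (m z * b z)) ->
  (forall z, U z -> 'd_v d z = k z * d z + 2 * (m z * b z)) ->
  (forall z, U z -> 'd_w d z = 3 * (m z * d z)) ->
  forall z, U z -> 9 * e z ^+ 2 * 'd_v ('d_v ('d_v e)) z - 45 * e z * 'd_v e z * 'd_v ('d_v e) z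
    + 40 * 'd_v e z ^+ 3 = 0.
Proof.
rewrite !fiber_diffE => oU se sb sd sk sm e0 D0 ev ew bv bw dv dw z Uz.
exact: (@monge_of_cubic R _ U (0, v) (0, w) oU e b d k m se sb sd sk sm e0 D0 ev ew bv bw dv dw z Uz).
Qed.

(** The premises are one vector identity evaluated on triples of v's and w's. Only v has to be
    non-radial: taken in this order, each identity loses its w terms through the coefficients
    already shown to be zero. *)
Lemma radial_cancel (R : realType) (I : Type) (y v w : I -> R) (t1 t2 t3 s1 s2 s3 s4 s5 s6 : R) :
  (forall t s, (forall i, t * v i = s * y i) -> t = 0 /\ s = 0) ->
  (forall i, t1 * v i + t1 * v i + t1 * v i = s1 * y i) ->
  (forall i, t1 * w i + t2 * v i + t2 * v i = s2 * y i) ->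
  (forall i, t2 * v i + t2 * v i + t1 * w i = s3 * y i) ->
  (forall i, t2 * w i + t3 * v i + t2 * w i = s4 * y i) ->
  (forall i, t3 * v i + t2 * w i + t2 * w i = s5 * y i) ->
  (forall i, t3 * w i + t3 * w i + t3 * w i = s6 * y i) ->
  [/\ t1 = 0, t2 = 0 & t3 = 0] /\ [/\ s1 = 0, s2 = 0 & s3 = 0] /\ [/\ s4 = 0, s5 = 0 & s6 = 0].
Proof.
move=> NR I1 I2 I3 I4 I5 I6.
have [|T1 S1] := NR (3 * t1) s1; first by move=> i; rewrite -I1; ring.
have t10 : t1 = 0 by lra.
have [|T2 S2] := NR (2 * t2) s2; first by move=> i; rewrite -I2 t10; ring.
have t20 : t2 = 0 by lra.
have [|_ S3] := NR 0 s3; first by move=> i; rewrite -I3 t10 t20; ring.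
have [|t30 S4] := NR t3 s4; first by move=> i; rewrite -I4 t20; ring.
have [|_ S5] := NR 0 s5; first by move=> i; rewrite -I5 t30 t20; ring.
have [|_ S6] := NR 0 s6; first by move=> i; rewrite -I6 t30; ring.
by [].
Qed.

(** * The vanishing Douglas tensor in one chart *)

Section DouglasChart.
Context {R : realType} {n : nat}.
Notation W := ('rV[R]_n * 'rV[R]_n)%type.
Implicit Types (f g : W -> R) (z : W) (u v w : 'rV[R]_n).
Variables (O : set 'rV[R]_n) (F : W -> R).
Hypothesis oO : open O.
Let A : set W := [set z | O z.1 /\ z.2 != 0].
Hypothesis F_ge0 : forall z, O z.1 -> 0 <= F z.
Hypothesis F_smooth : smooth_on A F.
Hypothesis F_hom : forall z (t : R), O z.1 -> 0 < t -> F (z.1, t *: z.2) = t * F z.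
Hypothesis F_posdef : forall z, A z -> posdef (fund_tensor F z).
Variables (mu : W -> 'rV[R]_n) (lam : W -> R).
Hypothesis n_ge3 : (3 <= n)%N.
Hypothesis lam_neq0 : forall U : set W, open U -> U `<=` A -> U !=set0 ->
  exists2 z, U z & lam z != 0.
Hypothesis berwald_form : forall z, A z -> forall i j k l : 'I_n,
  berwald F i j k l z =
    (mu z 0 j * angular F k l z + mu z 0 k * angular F j l z
     + mu z 0 l * angular F j k z) * z.2 0 i
    + lam z * (angular_mixed F i j z * angular F k l z
               + angular_mixed F i k z * angular F j l z
               + angular_mixed F i l z * angular F j k z).
Hypothesis douglas_zero : forall z, A z -> forall i j k l : 'I_n, douglas F i j k l z = 0.

Let oA : open A := open_slit oO.
Notation H u v z := ('d_u ('d_v F) z).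
Let sF v : smooth_on A ('d_v F) := smooth_fiber_diff v F_smooth.
Let sH u v : smooth_on A ('d_u ('d_v F)) := smooth_fiber_diff u (sF v).

Let F2_smooth : smooth_on A (fun p => F p ^+ 2) := smooth_on_exp 2 oA F_smooth.

Lemma smooth_spray i : smooth_on A (spray F i).
Proof.
have sg k l : smooth_on A (fun z => fund_tensor F z k l).
  have s : smooth_on A (fun z => 2^-1 * 'd_('e_k) ('d_('e_l) (fun p => F p ^+ 2)) z).
    apply: (smooth_on_mul oA (smooth_on_cst _)).
    exact: (smooth_fiber_diff 'e_k (smooth_fiber_diff 'e_l F2_smooth)).
  by apply: (eq_smooth_on oA _ s) => z _; rewrite mxE !dyE.
have si k l : smooth_on A (fun z => invmx (fund_tensor F z) k l).
  by apply: (smooth_on_invmx _ _ oA sg) => z Az; exact: posdef_unitmx (F_posdef Az).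
have sdx k f (fA : smooth_on A f) : smooth_on A (dx k f) := smooth_onD ('e_k, 0) fA.
have sdxy l k : smooth_on A (fun z => dx k (dy l (fun p => F p ^+ 2)) z * z.2 0 k).
  apply: (smooth_on_mul oA _ (@smooth_on_fiber_coord _ _ A k)).
  by apply: sdx; rewrite dyE; exact: (smooth_fiber_diff 'e_l F2_smooth).
have sx l : smooth_on A (fun z =>
    (\sum_k dx k (dy l (fun p => F p ^+ 2)) z * z.2 0 k) - dx l (fun p => F p ^+ 2) z).
  apply: (smooth_on_sub oA _ (sdx l _ F2_smooth)).
  exact: (smooth_on_sum (index_enum 'I_n) xpredT oA (sdxy l)).
have sl l := smooth_on_mul oA (si i l) (sx l).
exact: (smooth_on_mul oA (smooth_on_cst 4^-1) (smooth_on_sum (index_enum 'I_n) xpredT oA sl)).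
Qed.

Let E z : R := (n.+1%:R)^-1 * \sum_m 'd_('e_m) (spray F m) z.

Let sE : smooth_on A E.
Proof.
have sm m : smooth_on A ('d_('e_m) (spray F m)) := smooth_fiber_diff 'e_m (smooth_spray m).
exact: (smooth_on_mul oA (smooth_on_cst _) (smooth_on_sum (index_enum 'I_n) xpredT oA sm)).
Qed.

Let berwaldE z i j k l : A z ->
  'd_('e_j) ('d_('e_k) ('d_('e_l) (fun p => E p * p.2 0 i))) z = berwald F i j k l z.
Proof.
move=> Az; have D0 := douglas_zero Az i j k l; rewrite /berwald.
have dyf : @dy R n = (fun k => 'd_('e_k)) by apply/funext => m; apply/funext => f; rewrite dyE.
rewrite /douglas dyf in D0; rewrite dyf.
have : 'd_('e_j) ('d_('e_k) ('d_('e_l) (fun q => spray F i q - E q * q.2 0 i))) z = 0 := D0.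
have sy : smooth_on A (fun p => E p * p.2 0 i).
  exact: (smooth_on_mul oA sE (@smooth_on_fiber_coord _ _ A i)).
have sG := smooth_spray i.
have D1 p : A p -> 'd_('e_l) (fun q => spray F i q - E q * q.2 0 i) p =
    'd_('e_l) (spray F i) p - 'd_('e_l) (fun q => E q * q.2 0 i) p.
  by move=> Ap; exact: (fiber_diff_sub 'e_l Ap sG sy).
have s1 := smooth_fiber_diff 'e_l sG; have s2 := smooth_fiber_diff 'e_l sy.
have D2 p : A p -> 'd_('e_k) ('d_('e_l) (fun q => spray F i q - E q * q.2 0 i)) p =
    'd_('e_k) ('d_('e_l) (spray F i)) p - 'd_('e_k) ('d_('e_l) (fun q => E q * q.2 0 i)) p.
  by move=> Ap; rewrite (eq_fiber_diff oA 'e_k Ap D1) (fiber_diff_sub 'e_k Ap s1 s2).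
have s3 := smooth_fiber_diff 'e_k s1; have s4 := smooth_fiber_diff 'e_k s2.
rewrite (eq_fiber_diff oA 'e_j Az D2) (fiber_diff_sub 'e_j Az s3 s4).
by move=> /eqP; rewrite subr_eq0 => /eqP <-.
Qed.

(** The coefficient of F_kl y^i in the assumed curvature: F mu_j from its first part, and - lam F_j
    from the radial part of h^i_j multiplied by h_kl = F F_kl. *)
Let nu v z : R := F z * (\sum_j v 0 j * mu z 0 j) - lam z * 'd_v F z.

(** Both sides come from the third derivatives of E y^i: the Leibniz rule on one hand, the
    contracted Berwald form on the other. Terms along u, v, w are separated from those along y, so
    that independence can be applied. *)
Lemma douglas_identity z u v w i : A z ->
  ('d_v ('d_w E) z - lam z * F z * H v w z) * u 0 i
  + ('d_u ('d_w E) z - lam z * F z * H u w z) * v 0 i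
  + ('d_u ('d_v E) z - lam z * F z * H u v z) * w 0 i =
  (nu u z * H v w z + nu v z * H u w z + nu w z * H u v z - 'd_u ('d_v ('d_w E)) z) * z.2 0 i.
Proof.
move=> Az; have Fz : F z != 0 by rewrite gt_eqF// (F_gt0 oO F_ge0 F_smooth F_hom F_posdef).
have sy : smooth_on A (fun p => E p * p.2 0 i).
  exact: (smooth_on_mul oA sE (@smooth_on_fiber_coord _ _ A i)).
have L := fiber_diff3_mul_coord oA u v w i Az sE.
rewrite (fiber_diff3_sum oA u v w Az sy) in L.
pose c j := mu z 0 j * z.2 0 i + lam z * ((i == j)%:R - (F z)^-1 * z.2 0 i * 'd_('e_j) F z).
pose b j k := F z * H 'e_j 'e_k z.
have := trilinear_sum c b (u 0) (v 0) (w 0).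
have BE u' v' : \sum_j u' 0 j * \sum_k v' 0 k * b j k = F z * H u' v' z.
  rewrite (fiber_diff_sum oA u' Az (sF v')) mulr_sumr; apply: eq_bigr => j _.
  rewrite (fiber_hessC oO F_smooth 'e_j v' Az) (fiber_diff_sum oA v' Az (sF 'e_j)).
  rewrite mulrCA; congr (_ * _); rewrite mulr_sumr; apply: eq_bigr => k _.
  by rewrite /b (fiber_hessC oO F_smooth 'e_j 'e_k Az) mulrCA.
have CE u' : \sum_j u' 0 j * c j =
    (\sum_j u' 0 j * mu z 0 j) * z.2 0 i + lam z * (u' 0 i - (F z)^-1 * z.2 0 i * 'd_(u') F z).
  rewrite (fiber_diff_sum oA u' Az F_smooth) mulr_suml.
  have -> : u' 0 i = \sum_j u' 0 j * (i == j)%:R.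
    rewrite (bigD1 i)//= eqxx mulr1 big1 ?addr0// => j ji.
    by rewrite eq_sym (negbTE ji) mulr0.
  rewrite mulr_sumr -sumrB mulr_sumr -big_split/=; apply: eq_bigr => j _.
  by rewrite /c; ring.
rewrite /= !BE !CE => T.
move: L; rewrite (_ : \sum_j _ = \sum_j u 0 j * \sum_k v 0 k * \sum_l w 0 l *
    (c j * b k l + c k * b j l + c l * b j k)); last first.
  apply: eq_bigr => j _; congr (_ * _); apply: eq_bigr => k _; congr (_ * _).
  apply: eq_bigr => l _; congr (_ * _).
  rewrite (berwaldE i j k l Az) (berwald_form Az).
  rewrite !(angularE oO F_ge0 F_smooth F_hom F_posdef _ _ Az).
  rewrite !(angular_mixedE oO F_ge0 F_smooth F_hom F_posdef _ _ Az).
  by rewrite /c /b; ring.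
rewrite T /nu.
move: (\sum_j u 0 j * _) (\sum_j v 0 j * _) (\sum_j w 0 j * _) => mu1 mu2 mu3.
move: ('d_u F z) ('d_v F z) ('d_w F z) (H v w z) (H u w z) (H u v z) => f1 f2 f3 h1 h2 h3.
move: ('d_u ('d_v ('d_w E)) z) ('d_v ('d_w E) z) ('d_u ('d_w E) z) ('d_u ('d_v E) z) => e0 e1 e2 e3.
move: (F z) Fz (lam z) (z.2 0 i) (u 0 i) (v 0 i) (w 0 i) => f f0 l y a1 a2 a3 Hyp.
apply/eqP; rewrite -subr_eq0; apply/eqP.
transitivity (e0 * y + e1 * a1 + e2 * a2 + e3 * a3 - 
  (((mu1 * y + l * (a1 - f^-1 * y * f1)) * (f * h1) +
   (mu2 * y + l * (a2 - f^-1 * y * f2)) * (f * h2) +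
   (mu3 * y + l * (a3 - f^-1 * y * f3)) * (f * h3)))); first by field.
by rewrite Hyp subrr.
Qed.

Let F_pos z (Az : A z) : 0 < F z := F_gt0 oO F_ge0 F_smooth F_hom F_posdef Az.

Let not_radial z v (t s : R) : A z -> H v v z != 0 ->
  (forall i, t * v 0 i = s * z.2 0 i) -> t = 0 /\ s = 0.
Proof.
move=> Az h0 ts.
have t0 : t = 0.
  apply/eqP; apply: contraNT h0 => t0.
  have vE : v = (s / t) *: z.2.
    apply/rowP => i; rewrite mxE; apply: (mulfI t0); rewrite ts.
    by rewrite mulrA [t * _]mulrC divfK.
  rewrite {1}vE (fiber_hessZl oO F_smooth _ _ _ Az) (fiber_hess_radial oO F_smooth F_hom _ Az).
  by rewrite mulr0.
split => //; have [_ /rV0Pn[i yi]] := Az.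
by apply: (mulIf yi); rewrite -ts t0 !mul0r.
Qed.

(** Since radial vectors are in the kernel of the Hessian, [H v v z != 0] makes v non-radial. Both
    the tangential and the radial coefficients of [douglas_identity] then vanish, for every w. *)
Lemma mean_berwald_potential z v w : A z -> H v v z != 0 ->
  let f := lam z * F z in
  [/\ 'd_v ('d_v E) z = f * H v v z, 'd_v ('d_w E) z = f * H v w z &
      'd_w ('d_w E) z = f * H w w z] /\
  [/\ 'd_v ('d_v ('d_v E)) z = 3 * nu v z * H v v z,
      'd_w ('d_v ('d_v E)) z = 2 * nu v z * H v w z + nu w z * H v v z &
      'd_v ('d_v ('d_w E)) z = 2 * nu v z * H v w z + nu w z * H v v z] /\
  [/\ 'd_w ('d_v ('d_w E)) z = nu v z * H w w z + 2 * nu w z * H v w z,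
      'd_v ('d_w ('d_w E)) z = nu v z * H w w z + 2 * nu w z * H v w z &
      'd_w ('d_w ('d_w E)) z = 3 * nu w z * H w w z].
Proof.
move=> Az h0 f; have NR t s := not_radial (t := t) (s := s) Az h0.
have Ewv : 'd_w ('d_v E) z = 'd_v ('d_w E) z by exact: (fiber_diffC oA w v Az sE).
have Hwv : H w v z = H v w z by exact: (fiber_hessC oO F_smooth w v Az).
have I1 i := douglas_identity v v v i Az.
have I2 i := douglas_identity w v v i Az; rewrite Ewv Hwv in I2.
have I3 i := douglas_identity v v w i Az.
have I4 i := douglas_identity w v w i Az; rewrite Ewv Hwv in I4.
have I5 i := douglas_identity v w w i Az.
have I6 i := douglas_identity w w w i Az.
have := radial_cancel NR I1 I2 I3 I4 I5 I6; rewrite -/f.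
move: (nu v z) (nu w z) (H v v z) (H v w z) (H w w z) => a b p q r.
move=> [[/eqP t1 /eqP t2 /eqP t3] [[/eqP s1 /eqP s2 /eqP s3] [/eqP s4 /eqP s5 /eqP s6]]].
rewrite !subr_eq0 in t1 t2 t3 s1 s2 s3 s4 s5 s6.
move/eqP: t1 => ->; move/eqP: t2 => ->; move/eqP: t3 => ->.
move/eqP: s1 => <-; move/eqP: s2 => <-; move/eqP: s3 => <-.
move/eqP: s4 => <-; move/eqP: s5 => <-; move/eqP: s6 => <-.
by split; [|split]; split; ring.
Qed.


Lemma monge_generic z v w : A z -> lam z != 0 -> H v v z != 0 ->
  H v v z * H w w z - H v w z ^+ 2 != 0 ->
  9 * H v v z ^+ 2 * 'd_v ('d_v ('d_v ('d_v ('d_v F)))) z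
  - 45 * H v v z * 'd_v ('d_v ('d_v F)) z * 'd_v ('d_v ('d_v ('d_v F))) z
  + 40 * 'd_v ('d_v ('d_v F)) z ^+ 3 = 0.
Proof.
move=> Az lz ez Dz.
set e := 'd_v ('d_v F); set b := 'd_v ('d_w F); set d := 'd_w ('d_w F).
have se : smooth_on A e := sH v v; have sb : smooth_on A b := sH v w.
have sd : smooth_on A d := sH w w.
set Evv := 'd_v ('d_v E); set Evw := 'd_v ('d_w E); set Eww := 'd_w ('d_w E).
have sEvv : smooth_on A Evv := smooth_fiber_diff v (smooth_fiber_diff v sE).
(* E_vv = lam F F_vv replaces lam as a factor: it is smooth, so its nonvanishing defines an open
   set. *)
pose g p := e p * (Evv p * (e p * d p - b p ^+ 2)).
have sg : smooth_on A g.
  apply: (smooth_on_mul oA se); apply: (smooth_on_mul oA sEvv).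
  by apply: (smooth_on_sub oA); [exact: (smooth_on_mul oA se sd)|exact: (smooth_on_exp 2 oA sb)].
pose U := [set p | A p /\ g p != 0].
have oU : open U := open_nonzero oA sg.
have UA : U `<=` A by move=> p [].
have Ug p : U p -> [/\ e p != 0, Evv p != 0 & e p * d p - b p ^+ 2 != 0].
  by move=> [_]; rewrite /g !mulf_eq0 !negb_or => /and3P[].
have Uz : U z.
  have [[E1 _ _] _] := mean_berwald_potential w Az ez.
  split => //; rewrite /g /Evv E1 !mulf_neq0// gt_eqF//; exact: F_pos.
have seU := smooth_onS UA se; have sbU := smooth_onS UA sb; have sdU := smooth_onS UA sd.
have siU : smooth_on U (fun p => (e p)^-1) by apply: (smooth_on_inv oU _ seU) => p /Ug[].
(* This quotient equals lam F on U, but its smoothness is visible. *)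
pose phi p := Evv p * (e p)^-1.
have sphi : smooth_on U phi := smooth_on_mul oU (smooth_onS UA sEvv) siU.
(* kappa is nu / phi, and nu contains mu and lam; solving the equations for F_vvv and F_vvw gives
   expressions in F alone, hence smooth. *)
pose k p := 3^-1 * ('d_v e p * (e p)^-1).
have sk : smooth_on U k.
  apply: (smooth_on_mul oU (smooth_on_cst _)).
  exact: (smooth_on_mul oU (smooth_fiber_diff v seU) siU).
pose m p := ('d_w e p - 2 * (k p * b p)) * (e p)^-1.
have sm : smooth_on U m.
  apply: (smooth_on_mul oU _ siU); apply: (smooth_on_sub oU (smooth_fiber_diff w seU)).
  exact: (smooth_on_mul oU (smooth_on_cst 2) (smooth_on_mul oU sk sbU)).
have phiE p : U p -> [/\ phi p = lam p * F p, Evv p = phi p * e p, Evw p = phi p * b p &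
    Eww p = phi p * d p].
  move=> Up; have [e0 _ _] := Ug p Up.
  have [[E1 E2 E3] _] := mean_berwald_potential w (UA p Up) e0.
  have F1 : phi p = lam p * F p by rewrite /phi /Evv E1 mulfK.
  by split; rewrite ?F1.
have bv p : A p -> 'd_v b p = 'd_w e p.
  move=> Ap; rewrite /b /e -(fiber_diffC oA v w Ap (sF v)).
  apply: (eq_fiber_diff oA v Ap) => q Aq; exact: (fiber_hessC oO F_smooth v w Aq).
have dv p : A p -> 'd_v d p = 'd_w b p.
  by move=> Ap; rewrite /d /b (fiber_diffC oA v w Ap (sF w)).
have K p : U p -> [/\ 'd_v e p = 3 * (k p * e p), 'd_w e p = 2 * (k p * b p) + m p * e p,
    'd_w b p = k p * d p + 2 * (m p * b p) & 'd_w d p = 3 * (m p * d p)].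
  move=> Up; have Ap := UA p Up; have [e0 Ev0 D0] := Ug p Up.
  have [_ [[E1 E2 E3] [E4 E5 E6]]] := mean_berwald_potential w Ap e0.
  have pe : forall q, U q -> Evv q = phi q * e q by move=> q /phiE[].
  have pb : forall q, U q -> Evw q = phi q * b q by move=> q /phiE[].
  have pd : forall q, U q -> Eww q = phi q * d q by move=> q /phiE[].
  have phi0 : phi p != 0 by rewrite mulf_neq0// invr_neq0.
  have M t := fiber_diff_mul t Up sphi.
  apply: (@proportional_third_derivatives _ (e p) (b p) (d p) (phi p) ('d_v phi p) ('d_w phi p)
    (nu v p) (nu w p) ('d_v e p) ('d_w e p) ('d_w b p) ('d_w d p) e0 D0 phi0).
  - by rewrite -(M _ v seU) -(eq_fiber_diff oU v Up pe).
  - by rewrite -(M _ w seU) -(eq_fiber_diff oU w Up pe).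
  - by rewrite -(bv p Ap) -(M _ v sbU) -(eq_fiber_diff oU v Up pb).
  - by rewrite -(M _ w sbU) -(eq_fiber_diff oU w Up pb).
  - by rewrite -(dv p Ap) -(M _ v sdU) -(eq_fiber_diff oU v Up pd).
  - by rewrite -(M _ w sdU) -(eq_fiber_diff oU w Up pd).
apply: (@monge_fiber _ _ U v w e b d k m oU seU sbU sdU sk sm) Uz => p Up.
- by have [] := Ug p Up.
- by have [] := Ug p Up.
- by have [] := K p Up.
- by have [] := K p Up.
- by rewrite (bv p (UA p Up)); have [] := K p Up.
- by have [] := K p Up.
- by rewrite (dv p (UA p Up)); have [] := K p Up.
- by have [] := K p Up.
Qed.

(** Halphen's operator is continuous, so a nonzero value would persist on an open set, which
    contains a point with lam nonzero; there [monge_generic] contradicts it. *)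
Lemma monge z v : A z -> H v v z != 0 ->
  9 * H v v z ^+ 2 * 'd_v ('d_v ('d_v ('d_v ('d_v F)))) z
  - 45 * H v v z * 'd_v ('d_v ('d_v F)) z * 'd_v ('d_v ('d_v ('d_v F))) z
  + 40 * 'd_v ('d_v ('d_v F)) z ^+ 3 = 0.
Proof.
move=> Az h0.
set f2 := 'd_v ('d_v F); set f3 := 'd_v f2; set f4 := 'd_v f3; set f5 := 'd_v f4.
have s2 : smooth_on A f2 := sH v v.
have s3 : smooth_on A f3 := smooth_fiber_diff v s2.
have s4 : smooth_on A f4 := smooth_fiber_diff v s3.
have s5 : smooth_on A f5 := smooth_fiber_diff v s4.
pose g p := 9 * f2 p ^+ 2 * f5 p - 45 * f2 p * f3 p * f4 p + 40 * f3 p ^+ 3.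
have C c f (sf : smooth_on A f) : smooth_on A (fun p => c * f p).
  exact: (smooth_on_mul oA (smooth_on_cst c) sf).
have sg : smooth_on A g.
  apply: (smooth_on_add oA); last exact: (C 40 _ (smooth_on_exp 3 oA s3)).
  apply: (smooth_on_sub oA).
    exact: (smooth_on_mul oA (C 9 _ (smooth_on_exp 2 oA s2)) s5).
  exact: (smooth_on_mul oA (smooth_on_mul oA (C 45 _ s2) s3) s4).
rewrite -/(g z); apply/eqP/negPn/negP => gz.
(* The factor [f2] keeps v non-radial at the new point as well. *)
pose U := [set p | A p /\ f2 p * g p != 0].
have oU : open U := open_nonzero oA (smooth_on_mul oA s2 sg).
have [|z' [Az' +] lz'] := lam_neq0 oU (fun p (Up : U p) => proj1 Up).
  by exists z; split => //; rewrite mulf_neq0.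
rewrite mulf_eq0 negb_or => /andP[h0' /negP]; apply; apply/eqP.
have [w Hw] := exists_not_in_span2 z'.2 v n_ge3.
apply: (monge_generic (w := w) Az' lz' h0').
(* the Hessian is positive on t = H(v,w) v - H(v,v) w, and H(t,t) = H(v,v) (H(v,v) H(w,w) - H(v,w)^2) *)
pose t := H v w z' *: v + (- H v v z') *: w.
have tz c : t <> c *: z'.2.
  move=> tE; move: h0'; rewrite -[f2 z']/(H v v z') => /negP; apply.
  rewrite -oppr_eq0; apply/eqP; apply: (Hw (- c) (H v w z')).
  by rewrite -addrA -/t tE scaleNr addNr.
have := fiber_hess_gt0 oO F_ge0 F_smooth F_hom F_posdef Az' tz.
rewrite /t (fiber_hessDl oO F_smooth _ _ _ Az') !(fiber_hessZl oO F_smooth _ _ _ Az').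
rewrite !(fiber_hessDr oO F_smooth _ _ _ Az') !(fiber_hessZr oO F_smooth _ _ _ Az').
rewrite (fiber_hessC oO F_smooth w v Az').
move: (H v v z') (H v w z') (H w w z') => p q r pos.
apply: contraTneq pos => D0.
have -> : q * (q * p + - p * q) + - p * (q * q + - p * r) = p * (p * r - q ^+ 2) by ring.
by rewrite D0 mulr0 ltxx.
Qed.

End DouglasChart.

(** * Randers metrics in a chart *)

Section SmoothMatrices.
Context {R : realType} {V : normedModType R}.

Lemma continuous_mx m n (M : V -> 'M[R]_(m, n)) (x : V) :
  (forall i j, {for x, continuous (fun y => M y i j)}) -> {for x, continuous M}.
Proof.
move=> Mc; apply/cvgrPdist_le => e e0; near=> y.
rewrite /Num.Def.normr/= mx_normrE (bigmax_le _ (ltW e0))//= => -[i j] _ /=.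
rewrite !mxE; move: i j; near: y; apply: filter_forall => i; apply: filter_forall => j.
exact: ((cvgrPdist_le _ _).1 (Mc i j) e e0).
Unshelve. all: by end_near. Qed.

Lemma smooth_on_mx m n (A : set V) (M : V -> 'M[R]_(m, n)) : open A ->
  (forall i j, smooth_on A (fun x => M x i j)) -> smooth_on A M.
Proof.
move=> oA sM.
have dM (N : V -> 'M[R]_(m, n)) x v : (forall i j, derivable (fun y => N y i j) x v) ->
    derivable N x v by move=> dN; apply/derivable_mxP.
have E vs : forall x, A x -> (forall i j, iter_derive M vs x i j = iter_derive (fun y => M y i j) vs x)
    /\ forall v, derivable (iter_derive M vs) x v.
  elim: vs => [|w vs IH] x Ax.
    by split => // v; apply: dM => i j; exact: (smooth_on_derivable (sM i j) Ax).
  have E1 y : A y -> forall i j, iter_derive M (w :: vs) y i j =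
      iter_derive (fun y => M y i j) (w :: vs) y.
    move=> Ay i j; have [_ d] := IH y Ay.
    rewrite /= derive_mx// mxE; apply: (eq_derive_on w oA Ay) => q Aq.
    by have [-> _] := IH q Aq.
  split; first exact: E1.
  move=> v; apply: dM => i j.
  have [_ D] := sM i j (w :: vs) x Ax.
  apply: near_eq_derivable (D v).
  by apply: (near_open oA Ax) => y Ay; rewrite E1.
move=> vs x Ax; split; last by have [] := E vs x Ax.
apply: continuous_mx => i j.
have [c _] := sM i j vs x Ax; move: c; rewrite /continuous_at /prop_for.
have [-> _] := E vs x Ax; apply: cvg_trans; apply: near_eq_cvg.
by apply: (near_open oA Ax) => y Ay; have [-> _] := E vs y Ay.
Qed.

Context {V' : normedModType R}.

Lemma smooth_on_section (A : set (V * V')) (O : set V) (f : V * V' -> R) (c : V') :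
  (forall x, O x -> A (x, c)) -> smooth_on A f -> smooth_on O (fun x => f (x, c)).
Proof.
move=> OA /smooth_onP fA; apply/smooth_onP => k; move: (fA k) => {fA}.
have Q (g : V * V' -> R) x v : (fun h : R => h^-1 *: (g ((h *: v + x, c)) - g (x, c))) =
    (fun h : R => h^-1 *: (g (h *: ((v, 0) : V * V') + (x, c)) - g (x, c))).
  apply/funext => h; congr (_ *: (g _ - _)).
  by rewrite /GRing.scale/= -[RHS]/(h *: v + x, h *: 0 + c) scaler0 add0r.
have cs (g : V * V' -> R) x : {for (x, c), continuous g} -> {for x, continuous (fun y => g (y, c))}.
  move=> gc; apply: (@continuous_comp _ _ _ (fun y => (y, c)) g) => //.
  by apply: cvg_pair; [exact: cvg_id|exact: cvg_cst].
elim: k f => [|k IH] f [fc fd]; split => //; try by move=> x Ox; apply: cs; apply: fc; exact: OA.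
case: fd => fd fk; split => [x v Ox|v].
  by have := fd (x, c) (v, 0) (OA _ Ox); rewrite /derivable /= -Q.
have -> : 'D_v (fun x => f (x, c)) = (fun x => 'D_((v, 0) : V * V') f (x, c)).
  by apply/funext => x; rewrite /derive /= -Q.
exact: (IH _ (fk (v, 0))).
Qed.

End SmoothMatrices.

(** * Quadratic forms recognised by their values on lines *)

Section QuadraticForms.
Context {R : realType} {n : nat}.
Implicit Types (u v w y : 'rV[R]_n).

Lemma linear_form_coord (L : 'rV[R]_n -> R) (y : 'rV[R]_n) :
  (forall u v, L (u + v) = L u + L v) -> (forall (t : R) v, L (t *: v) = t * L v) ->
  L y = \sum_i y 0 i * L 'e_i.
Proof.
move=> LD LZ; rewrite {1}(row_sum_delta y).
elim: (index_enum _) => [|i s IH]; last by rewrite !big_cons LD LZ IH.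
by rewrite !big_nil -(scale0r 0) LZ mul0r.
Qed.

Variables (P : 'rV[R]_n -> R).
Hypothesis P_line : forall u v (t : R),
  P (u + t *: v) = P u + t * (P (u + v) - P u - P v) + t ^+ 2 * P v.

Definition polar u v : R := (P (u + v) - P u - P v) / 2.

Let P0 : P 0 = 0.
Proof. by have := P_line 0 0 2; rewrite scaler0 !addr0; lra. Qed.

Let PZ (t : R) v : P (t *: v) = t ^+ 2 * P v.
Proof. by have := P_line 0 v t; rewrite !add0r P0 subr0 subrr mulr0 !add0r. Qed.

Let par u v : P (u + v) + P (u - v) = 2 * P u + 2 * P v.
Proof. by have := P_line u v (-1); rewrite scaleN1r => ->; ring. Qed.

Lemma polarC u v : polar u v = polar v u.
Proof. by rewrite /polar [u + v]addrC; ring. Qed.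

(** The Jordan-von Neumann argument: a combination of four parallelogram identities. No continuity
    is required for scalars, since [P_line] already gives homogeneity. *)
Lemma polarDr u v w : polar u (v + w) = polar u v + polar u w.
Proof.
have h1 := par (u + v) w; have h2 := par (u + w) v; have h3 := par u (v - w); have h4 := par v w.
have E1 : u + w + v = u + v + w by rewrite addrAC.
have E2 : u + (v - w) = u + v - w by rewrite addrA.
have E3 : u - (v - w) = u + w - v by rewrite opprB addrA.
rewrite E1 in h2; rewrite E2 E3 in h3; rewrite /polar addrA; lra.
Qed.

Lemma polarZr (t : R) u v : polar u (t *: v) = t * polar u v.
Proof. by rewrite /polar P_line PZ; field. Qed.

Lemma polar_diag y : P y = polar y y.
Proof.
have -> : polar y y = (P (2 *: y) - P y - P y) / 2 by rewrite /polar scaler_nat mulr2n.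
by rewrite PZ; field.
Qed.

Lemma polar_coord u v : polar u v = \sum_i \sum_j polar 'e_i 'e_j * u 0 i * v 0 j.
Proof.
have E w w' : polar w w' = \sum_j w' 0 j * polar w 'e_j.
  by apply: (linear_form_coord (L := polar w)); [exact: polarDr|move=> t w0; exact: polarZr].
rewrite polarC E; apply: eq_bigr => i _; rewrite polarC E mulr_sumr.
by apply: eq_bigr => j _; ring.
Qed.

Lemma quadratic_form_coord y : P y = \sum_i \sum_j polar 'e_i 'e_j * y 0 i * y 0 j.
Proof. by rewrite polar_diag polar_coord. Qed.

End QuadraticForms.

Definition even_form (R : realType) (n : nat) (F : 'rV[R]_n * 'rV[R]_n -> R) (x y : 'rV[R]_n) : R :=
  even_part (fun v => F (x, v)) y ^+ 2.

(** Polarising alpha^2 at basis vectors involves F only at the fixed nonzero vectors e_i, e_i + e_j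
    and their opposites, so smoothness in x follows from that of F off the zero section. *)
Definition randers_metric (R : realType) (n : nat) (F : 'rV[R]_n * 'rV[R]_n -> R)
    (x : 'rV[R]_n) : 'M[R]_n := \matrix_(i, j) polar (even_form F x) 'e_i 'e_j.

Definition randers_form (R : realType) (n : nat) (F : 'rV[R]_n * 'rV[R]_n -> R)
    (x : 'rV[R]_n) : 'rV[R]_n := \row_i odd_part (fun v => F (x, v)) 'e_i.

(** * The Riemannian metric and the 1-form in one chart *)

Section RandersChart.
Context {R : realType} {n : nat}.
Notation W := ('rV[R]_n * 'rV[R]_n)%type.
Implicit Types (z : W) (x u v w y : 'rV[R]_n).
Variables (O : set 'rV[R]_n) (F : W -> R).
Hypothesis oO : open O.
Let A : set W := [set z | O z.1 /\ z.2 != 0].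
Hypothesis F_ge0 : forall z, O z.1 -> 0 <= F z.
Hypothesis F_smooth : smooth_on A F.
Hypothesis F_hom : forall z (t : R), O z.1 -> 0 < t -> F (z.1, t *: z.2) = t * F z.
Hypothesis F_posdef : forall z, A z -> posdef (fund_tensor F z).
Notation H u v z := ('d_u ('d_v F) z).
Hypothesis F_monge : forall z v, A z -> H v v z != 0 ->
  9 * H v v z ^+ 2 * 'd_v ('d_v ('d_v ('d_v ('d_v F)))) z
  - 45 * H v v z * 'd_v ('d_v ('d_v F)) z * 'd_v ('d_v ('d_v ('d_v F))) z
  + 40 * 'd_v ('d_v ('d_v F)) z ^+ 3 = 0.

Lemma randers_parts x : O x ->
  (forall u v, odd_part (fun y => F (x, y)) (u + v) =
     odd_part (fun y => F (x, y)) u + odd_part (fun y => F (x, y)) v) /\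
  (forall u v t, even_form F x (u + t *: v) = even_form F x u
   + t * (even_form F x (u + v) - even_form F x u - even_form F x v) + t ^+ 2 * even_form F x v).
Proof.
move=> Ox; pose N y := F (x, y); pose h v y := H v v (x, y).
have N_hom y (t : R) : 0 < t -> N (t *: y) = t * N y by move=> t0; exact: (F_hom (z := (x, y)) Ox t0).
have h_hom v y (t : R) : y != 0 -> 0 < t -> h v (t *: y) = t^-1 * h v y.
  move=> y0 t0.
  exact: (fiber_hess_hom oO F_smooth F_hom v (z := (x, y)) (conj Ox y0) t0).
have h_opp v y : y != 0 -> h (- v) y = h v y.
  move=> y0; have Az : A (x, y) by [].
  rewrite /h -scaleN1r (fiber_hessZl oO F_smooth _ _ _ Az) (fiber_hessZr oO F_smooth _ _ _ Az).
  by rewrite !mulN1r opprK.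
have h_swap u v (a b : R) : a *: u + b *: v != 0 ->
    a ^+ 2 * h u (a *: u + b *: v) = b ^+ 2 * h v (a *: u + b *: v).
  by move=> y0; exact: (fiber_hess_swap oO F_smooth F_hom (x := x) (conj Ox y0)).
have ind_neq0 u v : indep u v -> v != 0.
  by move=> uv; have := indep_neq0 (a := 0) (b := 1) uv; rewrite scale0r add0r scale1r oner_neq0 orbT; apply.
have h_gt0 u v : indep u v -> 0 < h u v.
  move=> uv; have v0 := ind_neq0 u v uv.
  apply: (fiber_hess_gt0 oO F_ge0 F_smooth F_hom F_posdef (z := (x, v)) (conj Ox v0)) => c uE.
  have [|/eqP] := uv 1 (- c); first by rewrite scale1r scaleNr uE subrr.
  by rewrite oner_eq0.
have N_line u v : indep u v ->
    exists f1 f3 f4 f5 : R -> R,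
    [/\ forall t : R, is_derive t 1 (fun s => N (u + s *: v)) (f1 t),
        forall t : R, is_derive t 1 f1 (h v (u + t *: v)),
        forall t : R, is_derive t 1 (fun s => h v (u + s *: v)) (f3 t),
        (forall t : R, is_derive t 1 f3 (f4 t)) /\ (forall t : R, is_derive t 1 f4 (f5 t)) &
        forall t : R, 9 * h v (u + t *: v) ^+ 2 * f5 t
          - 45 * h v (u + t *: v) * f3 t * f4 t + 40 * f3 t ^+ 3 = 0].
  move=> uv.
  have At (t : R) : A (x, u + t *: v).
    by split => //; apply: (ind_neq0 v); apply: indepC; exact: indep_line.
  have s1 := smooth_fiber_diff v F_smooth; have s2 := smooth_fiber_diff v s1.
  have s3 := smooth_fiber_diff v s2; have s4 := smooth_fiber_diff v s3.
  exists (fun t => 'd_v F (x, u + t *: v)), (fun t => 'd_v ('d_v ('d_v F)) (x, u + t *: v)),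
    (fun t => 'd_v ('d_v ('d_v ('d_v F))) (x, u + t *: v)),
    (fun t => 'd_v ('d_v ('d_v ('d_v ('d_v F)))) (x, u + t *: v)); split.
  - by move=> t; exact: (is_derive_fiber_line (At t) F_smooth).
  - by move=> t; exact: (is_derive_fiber_line (At t) s1).
  - by move=> t; exact: (is_derive_fiber_line (At t) s2).
  - split=> t; [exact: (is_derive_fiber_line (At t) s3)|exact: (is_derive_fiber_line (At t) s4)].
  - move=> t; apply: (F_monge (At t)); rewrite gt_eqF//; apply: (h_gt0 v).
    by apply: indepC; exact: indep_line.
split=> [u v|u v t].
  exact: (odd_partD N_hom h_hom h_opp h_swap h_gt0 N_line).
exact: (sqr_even_part_line N_hom h_hom h_opp h_swap h_gt0 N_line).
Qed.

Lemma Fx_hom x : O x -> forall y (t : R), 0 < t -> F (x, t *: y) = t * F (x, y).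
Proof. by move=> Ox y t t0; exact: (F_hom (z := (x, y)) Ox t0). Qed.

Lemma randers_formE x y : O x ->
  odd_part (fun v => F (x, v)) y = \sum_i randers_form F x 0 i * y 0 i.
Proof.
move=> Ox; have [oD _] := randers_parts Ox.
rewrite (linear_form_coord y oD); last by move=> t v; exact: (odd_part_hom (Fx_hom Ox)).
by apply: eq_bigr => i _; rewrite mxE mulrC.
Qed.

Lemma randers_metricE x y : O x ->
  even_form F x y = \sum_i \sum_j randers_metric F x i j * y 0 i * y 0 j.
Proof.
move=> Ox; have [_ eL] := randers_parts Ox; rewrite (quadratic_form_coord eL).
by apply: eq_bigr => i _; apply: eq_bigr => j _; rewrite mxE.
Qed.

Lemma randers_metric_sym x : (randers_metric F x)^T = randers_metric F x.
Proof. by apply/matrixP => i j; rewrite !mxE polarC. Qed.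

Lemma even_part_ge0 x y : O x -> 0 <= even_part (fun v => F (x, v)) y.
Proof. by move=> Ox; rewrite divr_ge0// addr_ge0// F_ge0. Qed.

Lemma randers_metric_posdef x : O x -> posdef (randers_metric F x).
Proof.
move=> Ox v v0; rewrite -(randers_metricE v Ox) exprn_gt0// divr_gt0// addr_gt0//.
  exact: (F_gt0 oO F_ge0 F_smooth F_hom F_posdef (z := (x, v)) (conj Ox v0)).
apply: (F_gt0 oO F_ge0 F_smooth F_hom F_posdef (z := (x, - v))).
by split => //=; rewrite oppr_eq0.
Qed.

Lemma randers_decomposition x y : O x ->
  F (x, y) = Num.sqrt (\sum_i \sum_j randers_metric F x i j * y 0 i * y 0 j)
             + \sum_i randers_form F x 0 i * y 0 i.
Proof.
move=> Ox; rewrite -randers_metricE// -randers_formE// sqrtr_sqr ger0_norm ?even_part_ge0//.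
by rewrite /even_part /odd_part; field.
Qed.

Lemma randers_form_norm x : O x ->
  Num.sqrt (\sum_i \sum_j invmx (randers_metric F x) i j
    * randers_form F x 0 i * randers_form F x 0 j) < 1.
Proof.
move=> Ox; set g := randers_metric F x; set b := randers_form F x.
have gu : g \in unitmx by apply: posdef_unitmx; exact: randers_metric_posdef.
set q := \sum_i _.
(* F is positive at y = - b g^-1, where its value is sqrt q - q *)
pose y := - (b *m invmx g).
have form (M : 'M[R]_n) (u : 'rV[R]_n) : \sum_i \sum_j M i j * u 0 i * u 0 j = (u *m M *m u^T) 0 0.
  rewrite mxE exchange_big/=; apply: eq_bigr => j _; rewrite mxE mulr_suml.
  by apply: eq_bigr => i _; rewrite !mxE; ring.
have qE : q = (b *m invmx g *m b^T) 0 0 by rewrite /q form.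
have giT : (invmx g)^T = invmx g by rewrite trmx_inv randers_metric_sym.
have gy : \sum_i \sum_j g i j * y 0 i * y 0 j = q.
  rewrite form qE /y mulNmx mulmxKV// raddfN/= trmx_mul giT.
  by rewrite mulNmx mulmxN opprK mulmxA.
have beta_y : \sum_i b 0 i * y 0 i = - q.
  rewrite qE [in RHS]mxE -sumrN; apply: eq_bigr => i _.
  by rewrite !mxE mulrN mulrC.
have q0 : 0 <= q by rewrite -gy -randers_metricE// sqr_ge0.
(* The test vector y must be nonzero, as F is positive only off the zero section. *)
have [b0|b0] := eqVneq b 0.
  by rewrite qE b0 !mul0mx mxE sqrtr0 ltr01.
have y0 : y != 0.
  apply: contra_neq b0; rewrite /y => /eqP; rewrite oppr_eq0 => /eqP E.
  by rewrite -(mulmxKV gu b) E mul0mx.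
have := F_gt0 oO F_ge0 F_smooth F_hom F_posdef (z := (x, y)) (conj Ox y0).
rewrite randers_decomposition// gy beta_y -{2}(sqr_sqrtr q0).
by move: (Num.sqrt q) (sqrtr_ge0 q) => r r0 rr; nra.
Qed.

Lemma smooth_randers_metric : smooth_on O (randers_metric F).
Proof.
have sF c : c != 0 -> smooth_on O (fun x => F (x, c)).
  by move=> c0; apply: (smooth_on_section _ F_smooth) => x Ox.
have se c : c != 0 -> smooth_on O (fun x => even_form F x c).
  move=> c0; apply: (smooth_on_exp 2 oO).
  apply: (smooth_on_mul oO _ (smooth_on_cst _)); apply: (smooth_on_add oO (sF c c0)).
  by apply: sF; rewrite oppr_eq0.
have ei (i : 'I_n) : ('e_i : 'rV[R]_n) != 0.
  by apply/rV0Pn; exists i; rewrite mxE !eqxx oner_neq0.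
(* For i = j the i-th coordinate is 2, hence also nonzero. *)
have eij (i j : 'I_n) : ('e_i + 'e_j : 'rV[R]_n) != 0.
  apply/rV0Pn; exists i; rewrite !mxE !eqxx/= gt_eqF// ltr_pwDl// ler0n.
apply: (smooth_on_mx oO) => i j.
have s := smooth_on_mul oO (smooth_on_sub oO (smooth_on_sub oO (se _ (eij i j)) (se _ (ei i))) (se _ (ei j)))
  (smooth_on_cst 2^-1).
by apply: (eq_smooth_on oO _ s) => x _; rewrite mxE.
Qed.

Lemma smooth_randers_form : smooth_on O (randers_form F).
Proof.
have sF c : c != 0 -> smooth_on O (fun x => F (x, c)).
  by move=> c0; apply: (smooth_on_section _ F_smooth) => x Ox.
have ei (i : 'I_n) : ('e_i : 'rV[R]_n) != 0.
  by apply/rV0Pn; exists i; rewrite mxE !eqxx oner_neq0.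
apply: (smooth_on_mx oO) => k i.
have ni : - ('e_i : 'rV[R]_n) != 0 by rewrite oppr_eq0.
have s := smooth_on_mul oO (smooth_on_sub oO (sF _ (ei i)) (sF _ ni)) (smooth_on_cst 2^-1).
by apply: (eq_smooth_on oO _ s) => x _; rewrite mxE.
Qed.

Lemma polar_even_form x u v : O x ->
  polar (even_form F x) u v = \sum_i \sum_j randers_metric F x i j * u 0 i * v 0 j.
Proof.
move=> Ox; have [_ eL] := randers_parts Ox; rewrite (polar_coord eL).
by apply: eq_bigr => i _; apply: eq_bigr => j _; rewrite mxE.
Qed.

End RandersChart.

(** * Transformation rules and conclusion on the manifold *)

Theorem proposition1 (R : realType) (n : nat) (M : topologicalType)
    (X : smooth_manifold R n M)
    (F : chart X -> 'rV[R]_n * 'rV[R]_n -> R)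
    (mu : chart X -> 'rV[R]_n * 'rV[R]_n -> 'rV[R]_n)
    (lam : chart X -> 'rV[R]_n * 'rV[R]_n -> R)
    (n_ge3 : (3 <= n)%N)
    (F_finsler : finsler F)
    (mu_covector : slit_covector mu)
    (lam_scalar : slit_function lam)
    (mu_homog : forall a, pos_homogeneous (-2) (slit_dom a) (mu a))
    (lam_homog : forall a, pos_homogeneous (W := R^o) (-1) (slit_dom a) (lam a))
    (* lam does not vanish identically on a nonempty open subset of TM_0 *)
    (lam_neq0 : forall (a : chart X) (U : set ('rV[R]_n * 'rV[R]_n)),
        open U -> U `<=` slit_dom a -> U !=set0 ->
        exists2 z, U z & lam a z != 0)
    (berwald_form : forall (a : chart X) (z : 'rV[R]_n * 'rV[R]_n),
        slit_dom a z -> forall i j k l : 'I_n,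
        berwald (F a) i j k l z =
          (mu a z 0 j * angular (F a) k l z + mu a z 0 k * angular (F a) j l z
           + mu a z 0 l * angular (F a) j k z) * z.2 0 i
          + lam a z *
            (angular_mixed (F a) i j z * angular (F a) k l z
             + angular_mixed (F a) i k z * angular (F a) j l z
             + angular_mixed (F a) i l z * angular (F a) j k z))
    (douglas_zero : forall (a : chart X) (z : 'rV[R]_n * 'rV[R]_n),
        slit_dom a z -> forall i j k l : 'I_n,
        douglas (F a) i j k l z = 0) :
  randers F.
Proof.
have [F_tm F_ge0 F_smooth F_hom F_posdef] := F_finsler.
have oO (a : chart X) : open (Defs.coord a @` dom a) := @coord_open _ _ _ X a.
have ge0 a z : (Defs.coord a @` dom a) z.1 -> 0 <= F a z by exact: F_ge0.
have hom a z (t : R) : (Defs.coord a @` dom a) z.1 -> 0 < t -> F a (z.1, t *: z.2) = t * F a z.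
  by move=> Oz t0; rewrite (F_hom a z t Oz t0) expr1z.
have monge_a a := monge (oO a) (ge0 a) (F_smooth a) (hom a) (F_posdef a) n_ge3 (lam_neq0 a)
  (berwald_form a) (douglas_zero a).
have overlapP a b x : overlap (X := X) a b x ->
    (Defs.coord a @` dom a) x /\ (Defs.coord b @` dom b) (transition a b x).
  move=> [p [pa pb] <-]; split; first by exists p.
  by exists p => //; rewrite /transition /= coordK.
split; first exact: F_finsler.
exists (fun a => randers_metric (F a)), (fun a => randers_form (F a)); split.
- split.
  + move=> a b x ab; have [Ox Ox'] := overlapP a b x ab.
    set J := trans_jac a b x; set x' := transition a b x.
    have FE y : F a (x, y) = F b (x', y *m J) by exact: (F_tm a b (x, y) ab).
    have PE y : even_form (F a) x y = even_form (F b) x' (y *m J).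
      by rewrite /even_form /even_part !FE mulNmx.
    apply/matrixP => i j; rewrite mxE.
    (* alpha^2 is a function on TM, so polarising at e_i and e_j in one chart is polarising at their
       images, the rows of J, in the other. *)
    have -> : polar (even_form (F a) x) 'e_i 'e_j = polar (even_form (F b) x') (row i J) (row j J).
      by rewrite /polar !PE mulmxDl -!rowE.
    rewrite (polar_even_form (oO b) (ge0 b) (F_smooth b) (hom b) (F_posdef b) (monge_a b) _ _ Ox').
    rewrite [RHS]mxE exchange_big/=; apply: eq_bigr => l _; rewrite [in RHS]mxE mulr_suml.
    by apply: eq_bigr => k _; rewrite [J^T _ _]mxE ![row _ J _ _]mxE; ring.
  + by move=> a; exact: smooth_randers_metric (oO a) (F_smooth a).
  + by move=> a x _; exact: randers_metric_sym.
  + move=> a x Ox.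
    exact: (randers_metric_posdef (oO a) (ge0 a) (F_smooth a) (hom a) (F_posdef a) (monge_a a) Ox).
- split; last by move=> a; exact: smooth_randers_form (oO a) (F_smooth a).
  move=> a b x ab; have [Ox Ox'] := overlapP a b x ab.
  set J := trans_jac a b x; set x' := transition a b x.
  have FE y : F a (x, y) = F b (x', y *m J) by exact: (F_tm a b (x, y) ab).
  apply/rowP => i; rewrite mxE /odd_part !FE mulNmx -rowE.
  rewrite -/(odd_part (fun v => F b (x', v)) (row i J)).
  rewrite (randers_formE (oO b) (ge0 b) (F_smooth b) (hom b) (F_posdef b) (monge_a b) _ Ox').
  by rewrite [RHS]mxE; apply: eq_bigr => k _; rewrite [J^T _ _]mxE [row _ _ _ _]mxE.
- move=> a x Ox.
  exact: (randers_form_norm (oO a) (ge0 a) (F_smooth a) (hom a) (F_posdef a) (monge_a a) Ox).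
- move=> a x y Ox.
  exact: (randers_decomposition (oO a) (ge0 a) (F_smooth a) (hom a) (F_posdef a) (monge_a a) y Ox).
Qed.
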